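(* Let $k$ be a field and let $A$ and $B$ be commutative Noetherian $k$-algebras such that $R=A\otimes_k B$ is Noetherian. Let $I\subseteq A$ and $J\subseteq B$ be nonzero proper ideals and let $n\ge 1$ be an integer. Assume that $I^t\ne I^{t+1}$ and $J^t\neq J^{t+1}$ for all $0\le t\le n-1$. Then $(I+J)^{(n)}=(I+J)^n$ if and only if $I^{(t)}=I^t$ and $J^{(t)}=J^t$ for all $1\le t\le n$.
   Context: For an ideal $Q$ of a commutative Noetherian ring $S$ and $n\ge 1$, the $n$-th symbolic power is $Q^{(n)}=S\cap\bigcap_{P\in\operatorname{Min}(Q)}Q^nS_P$, where $\operatorname{Min}(Q)$ is the set of minimal primes of $Q$ and the intersection with $S$ means the preimage in $S$. The symbols $I,J$ also denote the extensions of these ideals to $R$, so $I+J$ is an ideal of $R$; $I^{(t)}$ and $J^{(t)}$ are formed in $A$ and $B$, and $(I+J)^{(n)}$ in $R$. *)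

(* Defs.v *)
From HB Require Import structures.
From mathcomp Require Import all_boot all_order all_algebra.
From mathcomp Require Import sesquilinear ring_quotient generic_quotient.
From mathcomp Require Import boolp classical_sets functions cardinality.
From mathcomp Require Import ring.

Set Implicit Arguments.
Unset Strict Implicit.
Unset Printing Implicit Defensive.

Import GRing.Theory.
Local Open Scope classical_set_scope.
Local Open Scope quotient_scope.
Local Open Scope ring_scope.

(* Ideals are classical sets, possibly improper: the idealr of ring_quotient is
   proper, which excludes I^0 and the extension of an ideal to a ring where it
   becomes the unit ideal.  Prime ideals are the prime_idealr of the library. *)
Section Ideals.
Variable S : comNzRingType.
Implicit Types I J : set S.

Definition ideal I : Prop :=
  I 0 /\ forall a u v, I u -> I v -> I (a * u + v).

Definition ideal_gen (X : set S) : set S := smallest ideal X.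

Definition ideal_add I J : set S := [set x + y | x in I & y in J].

Definition ideal_mul I J : set S := ideal_gen [set x * y | x in I & y in J].

Definition ideal_exp I (n : nat) : set S := iter n (ideal_mul I) setT.

Definition noetherian : Prop :=
  forall I, ideal I -> exists2 X : set S, finite_set X & I = ideal_gen X.

Definition minimal_prime I (P : prime_idealr S) : Prop :=
  I `<=` [set` P] /\
  forall P' : prime_idealr S,
    I `<=` [set` P'] -> [set` P'] `<=` [set` P] -> [set` P'] = [set` P].

End Ideals.

Arguments noetherian : clear implicits.

Definition extension (S T : comNzRingType) (f : {rmorphism S -> T})
  (I : set S) : set T := ideal_gen (f @` I).

Module Localization.
Section Localization.
Variables (S : comNzRingType) (P : prime_idealr S).

Definition fracs := {x : S * S | x.2 \notin P}.
Implicit Types x y z : fracs.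

Local Notation num x := (\val x).1.
Local Notation den x := (\val x).2.

Lemma notin1 : 1 \notin P.
Proof. by rewrite idealr1. Qed.

Lemma notinM s t : s \notin P -> t \notin P -> s * t \notin P.
Proof. by move=> sP tP; rewrite prime_idealrM negb_or sP. Qed.

Definition mk (a s : S) (sP : s \notin P) : fracs :=
  exist (fun x : S * S => x.2 \notin P) (a, s) sP.

(* S need not be a domain, hence the multiplier u. *)
Definition equivl x y : bool :=
  `[< exists2 u, u \notin P & u * (num x * den y - num y * den x) = 0 >].

Lemma equivl_refl : reflexive equivl.
Proof. by move=> x; apply/asboolP; exists 1; rewrite ?notin1// subrr mulr0. Qed.

Lemma equivl_sym : symmetric equivl.
Proof.
by move=> x y; apply/asboolP/asboolP=> -[u uP e]; exists u => //;
  rewrite -opprB mulrN e oppr0.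
Qed.

Lemma equivl_trans : transitive equivl.
Proof.
move=> y x z /asboolP[u uP e] /asboolP[v vP e']; apply/asboolP.
exists (u * v * den y); first by rewrite !notinM// (valP y).
transitivity (v * den z * (u * (num x * den y - num y * den x)) +
              u * den x * (v * (num y * den z - num z * den y))).
  by ring.
by rewrite e e' !mulr0 addr0.
Qed.

Canonical equivl_equiv := EquivRel equivl equivl_refl equivl_sym equivl_trans.

Definition loc := {eq_quot equivl}.

HB.instance Definition _ : EqQuotient _ equivl loc := EqQuotient.on loc.
HB.instance Definition _ := Choice.on loc.

Lemma loc_eqP x y :
  reflect (exists2 u, u \notin P & u * (num x * den y - num y * den x) = 0)
          (x == y %[mod loc]).
Proof. by rewrite eqmodE; exact: asboolP. Qed.

Lemma repr_loc x : exists2 u, u \notin P &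
  u * (num x * den (repr (\pi_loc x)) - num (repr (\pi_loc x)) * den x) = 0.
Proof. by apply/loc_eqP; rewrite reprK. Qed.

Definition addl x y : fracs :=
  mk (num x * den y + num y * den x) (notinM (valP x) (valP y)).
Definition oppl x : fracs := mk (- num x) (valP x).
Definition mull x y : fracs := mk (num x * num y) (notinM (valP x) (valP y)).

Definition zero : loc := lift_cst loc (mk 0 notin1).
Definition one : loc := lift_cst loc (mk 1 notin1).
Definition add := lift_op2 loc addl.
Definition opp := lift_op1 loc oppl.
Definition mul := lift_op2 loc mull.

Canonical pi_zero_morph := PiConst zero.
Canonical pi_one_morph := PiConst one.

Lemma pi_add : {morph \pi : x y / addl x y >-> add x y}.
Proof.
move=> x y; unlock add; apply/eqP/loc_eqP => /=.
have [u uP e] := repr_loc x; have [v vP e'] := repr_loc y.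
move: (repr (\pi_loc x)) (repr (\pi_loc y)) e e' => x' y' e e'.
exists (u * v); first exact: notinM.
transitivity (v * den y * den y' * (u * (num x * den x' - num x' * den x)) +
              u * den x * den x' * (v * (num y * den y' - num y' * den y))).
  by ring.
by rewrite e e' !mulr0 addr0.
Qed.
Canonical pi_add_morph := PiMorph2 pi_add.

Lemma pi_opp : {morph \pi : x / oppl x >-> opp x}.
Proof.
move=> x; unlock opp; apply/eqP/loc_eqP => /=.
have [u uP e] := repr_loc x; exists u => //.
by rewrite !mulNr -opprD mulrN e oppr0.
Qed.
Canonical pi_opp_morph := PiMorph1 pi_opp.

Lemma pi_mul : {morph \pi : x y / mull x y >-> mul x y}.
Proof.
move=> x y; unlock mul; apply/eqP/loc_eqP => /=.
have [u uP e] := repr_loc x; have [v vP e'] := repr_loc y.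
move: (repr (\pi_loc x)) (repr (\pi_loc y)) e e' => x' y' e e'.
exists (u * v); first exact: notinM.
transitivity (v * num y * den y' * (u * (num x * den x' - num x' * den x)) +
              u * den x * num x' * (v * (num y * den y' - num y' * den y))).
  by ring.
by rewrite e e' !mulr0 addr0.
Qed.
Canonical pi_mul_morph := PiMorph2 pi_mul.

Lemma equal_fracs x y : num x * den y = num y * den x -> \pi_loc x = \pi_loc y.
Proof.
by move=> e; apply/eqP/loc_eqP; exists 1; rewrite ?notin1// e subrr mulr0.
Qed.

Lemma addA : associative add.
Proof.
elim/quotW=> x; elim/quotW=> y; elim/quotW=> z; rewrite !piE.
by apply: equal_fracs => /=; ring.
Qed.

Lemma addC : commutative add.
Proof.
by elim/quotW=> x; elim/quotW=> y; rewrite !piE; apply: equal_fracs => /=; ring.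
Qed.

Lemma add0l : left_id zero add.
Proof. by elim/quotW=> x; rewrite !piE; apply: equal_fracs => /=; ring. Qed.

Lemma addNl : left_inverse zero opp add.
Proof. by elim/quotW=> x; rewrite !piE; apply: equal_fracs => /=; ring. Qed.

HB.instance Definition _ := GRing.isZmodule.Build loc addA addC add0l addNl.

Lemma mulA : associative mul.
Proof.
elim/quotW=> x; elim/quotW=> y; elim/quotW=> z; rewrite !piE.
by apply: equal_fracs => /=; ring.
Qed.

Lemma mulC : commutative mul.
Proof.
by elim/quotW=> x; elim/quotW=> y; rewrite !piE; apply: equal_fracs => /=; ring.
Qed.

Lemma mul1l : left_id one mul.
Proof. by elim/quotW=> x; rewrite !piE; apply: equal_fracs => /=; ring. Qed.

Lemma mul_addl : left_distributive mul add.
Proof.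
elim/quotW=> x; elim/quotW=> y; elim/quotW=> z; rewrite !piE.
by apply: equal_fracs => /=; ring.
Qed.

Lemma one_neq0 : one != zero.
Proof.
rewrite !piE; apply/negP => /asboolP[u uP /=].
by rewrite !mulr1 subr0 mulr1 => u0; rewrite u0 rpred0 in uP.
Qed.

HB.instance Definition _ :=
  GRing.Zmodule_isComNzRing.Build loc mulA mulC mul1l mul_addl one_neq0.

Definition frac (a : S) : loc := \pi_loc (mk a notin1).

Lemma frac_is_zmod_morphism : zmod_morphism frac.
Proof.
move=> a b; rewrite /frac -[RHS]/(add _ (opp _)) !piE.
by apply: equal_fracs => /=; ring.
Qed.

Lemma frac_is_monoid_morphism : monoid_morphism frac.
Proof.
split=> [|a b]; first by rewrite -[RHS]/one !piE.
by rewrite -[RHS]/(mul _ _) /frac !piE; apply: equal_fracs => /=; ring.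
Qed.

HB.instance Definition _ :=
  GRing.isZmodMorphism.Build S loc frac frac_is_zmod_morphism.
HB.instance Definition _ :=
  GRing.isMonoidMorphism.Build S loc frac frac_is_monoid_morphism.

End Localization.
End Localization.
HB.export Localization.

Notation localization := Localization.loc.
Notation to_loc := Localization.frac.

Definition symbolic_power (S : comNzRingType) (Q : set S) (n : nat) : set S :=
  [set x | forall P : prime_idealr S, minimal_prime Q P ->
             extension (to_loc P) (ideal_exp Q n) (to_loc P x)].

(* R is a k-algebra tensor product of A and B, with a (x) b = iA a * iB b:
   universal property of the tensor product of k-vector spaces, the algebra
   structure being forced since iA and iB are algebra morphisms. *)
Definition is_tensor_product (k : fieldType) (A B R : comAlgType k)
    (iA : {lrmorphism A -> R}) (iB : {lrmorphism B -> R}) : Prop :=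
  forall (V : lmodType k) (f : {bilinear A -> B -> V}),
    exists2 g : {linear R -> V}, (forall a b, g (iA a * iB b) = f a b) &
      forall g' : {linear R -> V},
        (forall a b, g' (iA a * iB b) = f a b) -> g' =1 g.

(* Main.v *)
Require Import Defs.
From HB Require Import structures.
From mathcomp Require Import all_boot all_algebra.
From mathcomp Require Import sesquilinear ring_quotient generic_quotient.
From mathcomp Require Import boolp classical_sets cardinality.
From mathcomp Require Import ring zify.
Import GRing.Theory.
Local Open Scope ring_scope.
Set Implicit Arguments.
Unset Strict Implicit.
Unset Printing Implicit Defensive.
Local Open Scope classical_set_scope.

(* Write K(a, b) = aR + bR for ideals a of A and b of B.  Over a field,
   membership in K(a, b) is tested by the contractions id (x) phi : R -> A,
   where phi is a linear form on B that vanishes on b.  This gives (I+J)^n =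
   \bigcap_i K(I^i, J^(n+1-i)), that minimal primes of I + J contract to
   minimal primes of I, and that for y in J^(n-t) outside J^(n-t+1) one has x
   y in K(I^t, J^(n-t+1)) only if x in I^t.
   Since I^(t) J^(n-t) lies in (I+J)^(n), the last fact yields one
   implication. For the other, let L be the colon ideal of (I+J)^n by an
   element z of (I+J)^(n); no minimal prime of I + J contains L, and z must be
   shown to lie in each K(I^i, J^j) with i + j = n + 1.  As I^i and J^j have
   no embedded primes, taking a maximal annihilator reduces this to K(p, q)
   with p, q minimal over I, J, that is, to the fact that R/K(p, q) = A/p (x)
   B/q has no embedded primes. An element f of that ring is algebraic over a
   subdomain D = C (x) B/q whose nonzero elements are regular: C is generated
   by a transcendence basis of the A-components of f.  The lowest nonzero
   coefficient d of an algebraic relation gives f^m (d - f g) = 0, so that a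
   prime without regular elements is minimal. *)

(** * Ideals and prime ideals *)

Section IdealTheory.
Variable S : comNzRingType.
Implicit Types (I J Q L X : set S) (a b u v x y : S).

Lemma ideal0 I : ideal I -> I 0.
Proof. by case. Qed.

Lemma idealD I u v : ideal I -> I u -> I v -> I (u + v).
Proof. by move=> [_ h] Iu Iv; rewrite -[u]mul1r; exact: h. Qed.

Lemma idealMl I a u : ideal I -> I u -> I (a * u).
Proof. by move=> [i0 h] Iu; rewrite -[_ * _]addr0; exact: h. Qed.

Lemma idealMr I a u : ideal I -> I u -> I (u * a).
Proof. by rewrite mulrC; exact: idealMl. Qed.

Lemma idealN I u : ideal I -> I u -> I (- u).
Proof. by rewrite -mulN1r; exact: idealMl. Qed.

Lemma idealB I u v : ideal I -> I u -> I v -> I (u - v).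
Proof. by move=> iI Iu Iv; apply: idealD => //; exact: idealN. Qed.

Lemma idealDl I u v : ideal I -> I u -> I (u + v) -> I v.
Proof. by move=> iI Iu Iuv; rewrite -(addKr u v) addrC; apply: idealB. Qed.

Lemma ideal_sum (T : Type) (r : seq T) (P : pred T) I (F : T -> S) :
  ideal I -> (forall i, P i -> I (F i)) -> I (\sum_(i <- r | P i) F i).
Proof.
move=> iI IF; elim/big_ind: _ => //; first exact: ideal0.
by move=> u v; exact: idealD.
Qed.

Lemma idealT : ideal [set: S].
Proof. by []. Qed.

(** With [X] a singleton it also allows a claim about products with a fixed factor to be checked on
    generators only. *)
Lemma ideal_colon I X : ideal I ->
  ideal [set x | forall y, X y -> I (x * y)].
Proof.
move=> iI; split=> [y _|a u v hu hv y Xy /=]; first by rewrite mul0r; case: iI.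
by rewrite mulrDl -mulrA; apply: idealD; [|apply: idealMl;
  [|exact: hu]|exact: hv].
Qed.

Lemma ideal_gen_ideal X : ideal (ideal_gen X).
Proof.
split=> [Y [iY _]|a u v hu hv Y [iY XY]]; first exact: ideal0.
by apply: iY.2; [apply: hu|apply: hv].
Qed.

Lemma ideal_gen_sub X I : ideal I -> X `<=` I -> ideal_gen X `<=` I.
Proof. exact: smallest_sub. Qed.

Lemma mem_ideal_gen X : X `<=` ideal_gen X.
Proof. exact: sub_gen_smallest. Qed.

Lemma ideal_add_ideal I J : ideal I -> ideal J -> ideal (ideal_add I J).
Proof.
move=> iI iJ; split=> [|a _ _ [u Iu [v Jv <-]] [u' Iu' [v' Jv' <-]]].
  by exists 0; [exact: ideal0|exists 0; [exact: ideal0|rewrite addr0]].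
exists (a * u + u'); first by apply: iI.2.
by exists (a * v + v'); [apply: iJ.2|ring].
Qed.

Lemma ideal_addl I J x : ideal J -> I x -> ideal_add I J x.
Proof.
by move=> iJ Ix; exists x => //; exists 0; [exact: ideal0|rewrite addr0].
Qed.

Lemma ideal_addr I J x : ideal I -> J x -> ideal_add I J x.
Proof.
by move=> iI Jx; exists 0; [exact: ideal0|exists x; rewrite ?add0r].
Qed.

Lemma ideal_add_sub I J L :
  ideal L -> I `<=` L -> J `<=` L -> ideal_add I J `<=` L.
Proof.
by move=> iL IL JL _ [x /IL Lx [y /JL Ly <-]]; exact: idealD.
Qed.

Lemma ideal_addC I J : ideal_add I J = ideal_add J I.
Proof.
by apply/seteqP; split=> _ [x Ix [y Jy <-]]; exists y => //; exists x;
  rewrite // addrC.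
Qed.

Lemma mem_ideal_mul I J x y : I x -> J y -> ideal_mul I J (x * y).
Proof. by move=> Ix Jy; apply: mem_ideal_gen; exists x => //; exists y. Qed.

Lemma ideal_mul_sub I J L : ideal L ->
  (forall x y, I x -> J y -> L (x * y)) -> ideal_mul I J `<=` L.
Proof.
move=> iL h; apply: ideal_gen_sub => // _ [x Ix [y Jy <-]]; exact: h.
Qed.

Lemma ideal_exp_ideal I n : ideal (ideal_exp I n).
Proof. by case: n => [|n]; [exact: idealT|exact: ideal_gen_ideal]. Qed.

Lemma ideal_exp_subl I m n :
  (m <= n)%N -> ideal_exp I n `<=` ideal_exp I m.
Proof.
move=> /subnK <-; elim: (n - m)%N => // l IH.
rewrite addSn; apply: ideal_mul_sub => [|x y _ /IH].
  exact: ideal_exp_ideal.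
by apply: idealMl; exact: ideal_exp_ideal.
Qed.

Lemma ideal_expM I m n x y : ideal_exp I m x -> ideal_exp I n y ->
  ideal_exp I (m + n) (x * y).
Proof.
move=> + ny; elim: m x => [|m IH] x.
  by move=> _; apply: idealMl => //; exact: ideal_exp_ideal.
pose L := [set x | forall z, z = y -> ideal_exp I (m.+1 + n) (x * z)].
suff: ideal_exp I m.+1 `<=` L by move=> h /h; exact.
apply: ideal_mul_sub.
  by apply: (ideal_colon [set z | z = y]); exact: ideal_exp_ideal.
move=> a b Ia /IH h _ ->; rewrite -mulrA addSn.
exact: mem_ideal_mul.
Qed.

(** A product of [n] factors from [I + J] expands into terms with at least [i] factors from [I] or
    at least [j] from [J]. The induction splits off one factor, which lowers [i] or [j]; at index 0
    the right side is the whole ring. *)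
Lemma ideal_exp_add_sub I J i j n : ideal I -> ideal J -> (i + j <= n.+1)%N ->
  ideal_exp (ideal_add I J) n
    `<=` ideal_add (ideal_exp I i) (ideal_exp J j).
Proof.
move=> iI iJ.
have iE l m : ideal (ideal_add (ideal_exp I l) (ideal_exp J m)).
  by apply: ideal_add_ideal; exact: ideal_exp_ideal.
elim: n i j => [|n IH] [|i] [|j] ijn x.
- by move=> _; apply: ideal_addl => //; exact: ideal_exp_ideal.
- by move=> _; apply: ideal_addl => //; exact: ideal_exp_ideal.
- by move=> _; apply: ideal_addr => //; exact: ideal_exp_ideal.
- by move: ijn; rewrite addSn addnS.
- by move=> _; apply: ideal_addl => //; exact: ideal_exp_ideal.
- by move=> _; apply: ideal_addl => //; exact: ideal_exp_ideal.
- by move=> _; apply: ideal_addr => //; exact: ideal_exp_ideal.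
move: x; apply: ideal_mul_sub => // _ y [a Ia [b Jb <-]] ny.
rewrite mulrDl; apply: idealD => //.
- have [|u Iu [v Jv <-]] := IH i j.+1 _ _ ny; first by rewrite addSn in ijn.
  rewrite mulrDr; apply: idealD => //.
    by apply: ideal_addl; [exact: ideal_exp_ideal|exact: mem_ideal_mul].
  apply: ideal_addr; first exact: ideal_exp_ideal.
  exact: idealMl (ideal_exp_ideal _ _) Jv.
- have [|u Iu [v Jv <-]] := IH i.+1 j _ _ ny; first by rewrite addnS in ijn.
  rewrite mulrDr; apply: idealD => //.
    apply: ideal_addl; first exact: ideal_exp_ideal.
    exact: idealMl (ideal_exp_ideal _ _) Iu.
  by apply: ideal_addr; [exact: ideal_exp_ideal|exact: mem_ideal_mul].
Qed.

Lemma mem_prime_exp I (P : prime_idealr S) n :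
  ideal_exp I n `<=` [set` P] -> I `<=` [set` P].
Proof.
move=> IP x Ix; suff h m : ideal_exp I m (x ^+ m).
  have := IP _ (h n); rewrite /=; elim: n {IP h} => [|n IH].
    by rewrite expr0 idealr1.
  by rewrite exprS prime_idealrM => /orP[|/IH].
by elim: m => // m IH; rewrite exprS; exact: mem_ideal_mul.
Qed.

Definition prime_set (X : set S) : Prop :=
  [/\ ideal X, ~ X 1 & forall a b, X (a * b) -> X a \/ X b].

Lemma idealr_ideal (P : prime_idealr S) : ideal [set` P].
Proof.
split=> [|a u v /= Pu Pv]; first exact: rpred0.
by apply: rpredD => //; rewrite prime_idealrM Pu orbT.
Qed.

Lemma prime_set_idealr (P : prime_idealr S) : prime_set [set` P].
Proof.
split; [exact: idealr_ideal|by rewrite /= idealr1|].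
by move=> a b /=; rewrite prime_idealrM => /orP.
Qed.

Lemma prime_set_ex X : prime_set X -> exists P : prime_idealr S, [set` P] = X.
Proof.
move=> [iX X1 Xm]; pose p : {pred S} := fun x => `[< X x >].
have pE x : (x \in p) = `[< X x >] by [].
have c : idealr_closed p.
  split.
  - by rewrite pE; apply/asboolP; exact: ideal0.
  - by rewrite pE; apply/asboolP.
  - by move=> a u v; rewrite !pE => /asboolP ? /asboolP ?; apply/asboolP;
    apply: iX.2.
have q : prime_idealr_closed p.
  move=> a b; rewrite !pE => /asboolP /Xm[]/asboolP-> //.
  by rewrite orbT.
pose i1 := isIdealr.Build S p c.
pose i2 := isPrimeIdealrClosed.Build S p q.
pose P : prime_idealr S := HB.pack p i1 i2.
exists P; apply/seteqP; split=> x /=; first by move=> /asboolP.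
by move=> Xx; apply/asboolP.
Qed.

End IdealTheory.

(** * Existence of primes, symbolic powers *)

Section Primes.
Variable S : comNzRingType.
Implicit Types (I J Q L X M : set S) (a b u v x y : S).

(** Otherwise choice produces a strictly ascending chain; its union is an ideal whose finitely many
    generators already lie in one member. *)
Lemma noetherian_max (F : set S -> Prop) : noetherian S ->
  (forall X, F X -> ideal X) -> (exists X, F X) ->
  exists2 X, F X & forall Y, F Y -> X `<=` Y -> Y `<=` X.
Proof.
move=> noeth Fi [X0 FX0]; apply: contrapT => nomax.
(* [F X] is a premise under the existential so that [choice] yields a function on all sets. *)
have next X : exists Y, F X -> [/\ F Y, X `<=` Y & ~ Y `<=` X].
  have [FX|nFX] := pselect (F X); last by exists X.
  apply: contrapT => no; apply: nomax; exists X => // Y FY XY.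
  by apply: contrapT => nYX; apply: no; exists Y.
have [f fP] := choice next.
pose c n := iter n f X0.
have cF n : F (c n) by elim: n => // n /fP[].
have cS m n : (m <= n)%N -> c m `<=` c n.
  move=> /subnK <-; elim: (n - m)%N => // l IH.
  by apply: (subset_trans IH); have [] := fP _ (cF (l + m)%N).
pose U := \bigcup_n c n.
have iU : ideal U.
  split=> [|a u v [m _ cu] [n _ cv]]; first by exists 0%N => //; apply: ideal0;
    exact: Fi (cF 0%N).
  exists (maxn m n) => //; apply: (Fi _ (cF _)).2.
    exact: cS (leq_maxl _ _) _ cu.
  exact: cS (leq_maxr _ _) _ cv.
have [X /finite_seqP[s ->] UE] := noeth _ iU.
have [N sN] : exists N, [set` s] `<=` c N.
  have : [set` s] `<=` U by rewrite UE; exact: mem_ideal_gen.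
  elim: s {UE} => [|x s IH] sU; first by exists 0%N.
  have [|N sN] := IH; first by move=> y ys; apply: sU; rewrite /= inE ys orbT.
  have [|m _ xm] := sU x; first by rewrite /= mem_head.
  exists (maxn m N) => y; rewrite /= inE => /orP[/eqP->|ys].
    exact: cS (leq_maxl _ _) _ xm.
  exact: cS (leq_maxr _ _) _ (sN _ ys).
have [_ _] := fP _ (cF N); apply.
apply: (@subset_trans _ U); first by move=> x fx; exists N.+1.
by rewrite UE; apply: ideal_gen_sub => //; exact: Fi.
Qed.

(** An ideal maximal among those that contain [Q] and avoid the multiplicative set [M] is prime. *)
Lemma prime_avoiding Q M : noetherian S -> ideal Q ->
  M 1 -> (forall a b, M a -> M b -> M (a * b)) -> (forall x, Q x -> ~ M x) ->
  exists P : prime_idealr S, Q `<=` [set` P] /\ forall x, x \in P -> ~ M x.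
Proof.
move=> noeth iQ M1 MM QM.
have [||X [iX QX XM] Xmax] := @noetherian_max
    (fun X => [/\ ideal X, Q `<=` X & forall x, X x -> ~ M x]) noeth.
- by move=> X [].
- by exists Q; split.
have meet a : ~ X a -> exists x r, X x /\ M (x + r * a).
  move=> Xa; apply: contrapT => no; apply: Xa.
  pose Y := [set y | exists x r, X x /\ y = x + r * a].
  have XY : X `<=` Y by move=> x Xx; exists x, 0; rewrite mul0r addr0.
  apply: (Xmax Y); last 2 first.
  - exact: XY.
  - by exists 0, 1; rewrite add0r mul1r; split=> //; exact: ideal0.
  split.
  - split=> [|c _ _ [x [r [Xx ->]]] [x' [r' [Xx' ->]]]]; first by apply: XY;
    exact: ideal0.
    by exists (c * x + x'), (c * r + r'); split; [apply: iX.2|ring].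
  - by move=> x /QX; exact: XY.
  - by move=> _ [x [r [Xx ->]]] Mx; apply: no; exists x, r.
have [P PE] : exists P : prime_idealr S, [set` P] = X.
  apply: prime_set_ex; split=> // [/XM//|a b Xab].
  apply: contrapT => /not_orP[/meet[x [r [Xx Mx]]] /meet[y [s [Xy My]]]].
  apply: (XM _ _ (MM _ _ Mx My)).
  have -> : (x + r * a) * (y + s * b) =
            (y + s * b) * x + (r * a * y + r * s * (a * b)) by ring.
  by apply: iX.2 => //; apply: idealD => //; exact: idealMl.
exists P; rewrite PE; split=> // x Px; apply: XM.
by rewrite -PE.
Qed.

(** Otherwise some prime over [Q] avoids every product of a power of [y] with an element outside
    [P]; it lies in [P] and misses [y], against minimality. *)
Lemma minimal_prime_nilp Q (P : prime_idealr S) y : noetherian S -> ideal Q ->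
  minimal_prime Q P -> y \in P ->
  exists m, exists2 u, u \notin P & Q (u * y ^+ m).
Proof.
move=> noeth iQ [QP Pmin] yP; apply: contrapT => no.
pose M := [set x | exists m, exists2 u, u \notin P & x = u * y ^+ m].
have [||x Qx [m [u uP xE]]|P' [QP' P'M]] := @prime_avoiding Q M noeth iQ.
- by exists 0%N, 1; rewrite ?idealr1 ?mulr1.
- move=> _ _ [m [u uP ->]] [n [v vP ->]]; exists (m + n)%N, (u * v).
    by rewrite prime_idealrM negb_or uP.
  by rewrite exprD; ring.
- by apply: no; exists m, u; rewrite -?xE.
have P'P : [set` P'] `<=` [set` P].
  move=> x /P'M; apply: contra_notP => /= /negP xP.
  by exists 0%N, x; rewrite ?mulr1.
have : y \in P' by have := Pmin _ QP' P'P => /seteqP[_]; apply.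
by move=> /P'M; apply; exists 1%N, 1; rewrite ?idealr1 ?mul1r.
Qed.

(** Zorn's lemma for reverse inclusion: the intersection of a nonempty chain of primes is prime. *)
Lemma minimal_prime_ex Q (P : prime_idealr S) : Q `<=` [set` P] ->
  exists2 P0 : prime_idealr S, minimal_prime Q P0 & [set` P0] `<=` [set` P].
Proof.
move=> QP.
pose T := {X : set S | [/\ prime_set X, Q `<=` X & X `<=` [set` P]]}.
pose R (s t : T) := `[< sval t `<=` sval s >].
pose t0 : T := exist _ [set` P] (And3 (prime_set_idealr P) QP (@subset_refl _
  _)).
have [|s t r|A Atot|[X [Xp QX XP]] Xmax] := @ZL_preorder T t0 R.
- by move=> s; apply/asboolP.
- by move=> /asboolP h /asboolP h'; apply/asboolP; exact: subset_trans h.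
- have [[s0 As0]|A0] := pselect (exists s, A s); last first.
    by exists t0 => s As; case: A0; exists s.
  pose X := [set x | forall s, A s -> sval s x].
  have XP s : A s -> X `<=` sval s by move=> As x; exact.
  have h1 : [/\ prime_set X, Q `<=` X & X `<=` [set` P]].
    split=> [|x Qx s As|]; last 2 first.
    + by have [_ + _] := svalP s; exact.
    + by have [_ _ h] := svalP s0; exact: subset_trans (XP _ As0) h.
    split.
    + split=> [s As|a u v Xu Xv s As]; have [[i _ _] _ _] := svalP s.
        exact: ideal0.
      by apply: i.2; [exact: Xu|exact: Xv].
    + by move=> /(_ _ As0); have [[]] := svalP s0.
    + move=> a b Xab; apply: contrapT => /not_orP[].
      move=> /existsNP[s /not_implyP[As sa]].
      move=> /existsNP[t /not_implyP[At tb]].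
      have [[_ _ sM] _ _] := svalP s; have [[_ _ tM] _ _] := svalP t.
      have [/asboolP h|/asboolP h] := Atot _ _ As At.
        by have [/h|] := tM _ _ (Xab _ At).
      by have [|/h] := sM _ _ (Xab _ As).
  by exists (exist _ X h1) => s As; apply/asboolP; exact: XP.
have [P0 P0E] := prime_set_ex Xp; exists P0; last by rewrite P0E.
split=> [|P' QP']; rewrite P0E // => P'X; apply/seteqP; split=> //;
  apply/asboolP.
have h := And3 (prime_set_idealr P') QP' (subset_trans P'X XP).
by apply: (Xmax (exist _ _ h)); apply/asboolP.
Qed.

(** Elements of the extended ideal are fractions with numerator in [Q^n], and equality of fractions
    is tested after multiplication by an element outside [P]. *)
Lemma symbolic_powerP Q n x :
  symbolic_power Q n x <->
  forall P : prime_idealr S, minimal_prime Q P ->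
    exists2 s, s \notin P & ideal_exp Q n (s * x).
Proof.
have iE := @ideal_exp_ideal S Q n.
split=> h P Pmin; last first.
  have [s sP sx] := h P Pmin.
  pose i := (\pi_(localization P) (Localization.mk 1 sP))%qT.
  have iK : i * to_loc P s = 1.
    rewrite -[LHS]/(Localization.mul _ _) -[RHS]/(Localization.one P) /i.
    by rewrite /to_loc !piE; apply: Localization.equal_fracs => /=; ring.
  rewrite -[to_loc P x]mul1r -iK -mulrA -rmorphM.
  apply: (idealMl _ (ideal_gen_ideal _)).
  by apply: mem_ideal_gen; exists (s * x).
(* The fractions with numerator in [Q^n], stated without division; they form an ideal, which
   therefore contains the extension. *)
pose Y := [set y : localization P | exists a s,
  [/\ ideal_exp Q n a, s \notin P & y * to_loc P s = to_loc P a]].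
have sub : extension (to_loc P) (ideal_exp Q n) `<=` Y.
  apply: ideal_gen_sub => [|_ [a Qa <-]]; last first.
    by exists a, 1; split; rewrite ?idealr1 // rmorph1 mulr1.
  split=> [|c u v [a [s [Qa sP e]]] [b [t [Qb tP f]]]].
    by exists 0, 1; split; rewrite ?idealr1 ?mul0r ?rmorph0 //; exact: ideal0.
  have [d [w wP g]] : exists d, exists2 w, w \notin P & c * to_loc P w = to_loc
    P d.
    elim/quotW: c => [[[d w] wP]]; exists d, w => //.
    rewrite -[LHS]/(Localization.mul _ _) /to_loc !piE.
    by apply: Localization.equal_fracs => /=; ring.
  exists (d * a * t + w * s * b), (w * s * t); split.
  - by apply: idealD => //; [apply: idealMr => //|]; exact: idealMl.
  - by rewrite !prime_idealrM !negb_or wP sP.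
  - rewrite rmorphD !rmorphM /= -e -f -g; ring.
have [a [s [Qa sP]]] := sub _ (h P Pmin).
rewrite -rmorphM => /eqP /Localization.loc_eqP[u uP /=].
rewrite !mulr1 mulrBr => /eqP; rewrite subr_eq0 => /eqP e.
exists (u * s); first by rewrite prime_idealrM negb_or uP.
by rewrite -mulrA [s * x]mulrC e; exact: idealMl.
Qed.

Lemma sub_symbolic_power Q n : ideal_exp Q n `<=` symbolic_power Q n.
Proof.
by move=> x Qx; apply/symbolic_powerP => P _; exists 1; rewrite ?idealr1 ?mul1r.
Qed.

End Primes.

(** * Linear forms and contractions of a tensor product *)

Definition subspace (k : fieldType) (V : lmodType k) (W : set V) : Prop :=
  W 0 /\ forall (c : k) u v, W u -> W v -> W (c *: u + v).

Lemma ideal_subspace (k : fieldType) (A : comAlgType k) (I : set A) :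
  ideal I -> subspace I.
Proof.
move=> iI; split=> [|c u v Iu Iv]; first exact: ideal0.
by rewrite -mulr_algl; exact: iI.2.
Qed.

(** A subspace maximal among those that contain [W] and avoid [v] is a complement of the line of
    [v]; [phi] is the coordinate along [v]. *)
Lemma separating_functional (k : fieldType) (V : lmodType k) (W : set V) v :
  subspace W -> ~ W v -> exists phi : {linear V -> k^o},
    (forall w, W w -> phi w = 0) /\ phi v = 1.
Proof.
move=> sW Wv.
pose T := {X : set V | [/\ subspace X, W `<=` X & ~ X v]}.
pose R (s t : T) := `[< sval s `<=` sval t >].
pose t0 : T := exist _ W (And3 sW (@subset_refl _ _) Wv).
have [|r s t|F Ftot|[X XP] Xmax] := @ZL_preorder T t0 R.
- by move=> s; apply/asboolP.
- by move=> /asboolP h /asboolP h'; apply/asboolP; exact: subset_trans h'.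
- have [[s0 Fs0]|F0] := pselect (exists s, F s); last first.
    by exists t0 => s Fs; case: F0; exists s.
  pose X := [set x | exists2 s, F s & sval s x].
  have XP s : F s -> sval s `<=` X by move=> Fs x sx; exists s.
  have h : [/\ subspace X, W `<=` X & ~ X v].
    split.
    - split=> [|c x y [s Fs sx] [t Ft ty]].
        by exists s0 => //; have [[]] := svalP s0.
      have [/asboolP st|/asboolP ts] := Ftot _ _ Fs Ft.
        exists t => //; have [[_ l] _ _] := svalP t; apply: l => //; exact: st.
      exists s => //; have [[_ l] _ _] := svalP s; apply: l => //; exact: ts.
    - by have [_ h _] := svalP s0; apply: subset_trans h _; exact: XP.
    - by move=> [s _ sv]; have [_ _] := svalP s; exact.
  by exists (exist _ X h) => s Fs; apply/asboolP; exact: XP.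
have [[X0 Xl] WX Xv] := XP.
have XZ c x : X x -> X (c *: x) by move=> Xx; rewrite -[_ *: _]addr0; exact: Xl.
have XD x y : X x -> X y -> X (x + y) by rewrite -{2}[x]scale1r; exact: Xl.
have XB x y : X x -> X y -> X (x - y).
  by move=> Xx Xy; apply: XD => //; rewrite -scaleN1r; exact: XZ.
(* If this fails, [X] plus the line of [x] is a larger subspace that still avoids [v]. *)
have coord x : exists c, X (x - c *: v).
  have [Xx|Xx] := pselect (X x); first by exists 0; rewrite scale0r subr0.
  apply: contrapT => no.
  pose Y := [set y | exists c, X (y - c *: x)].
  have sY : subspace Y.
    split=> [|d y z [c Xc] [c' Xc']].
      by exists 0; rewrite scale0r subr0.
    exists (d * c + c'); have := Xl d _ _ Xc Xc'.
    by rewrite scalerBr scalerA addrACA -opprD -scalerDl.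
  have XY : X `<=` Y by move=> y Xy; exists 0; rewrite scale0r subr0.
  have Yv : ~ Y v.
    move=> [c Xc]; have c0 : c != 0.
      by apply/eqP => c0; apply: Xv; rewrite c0 scale0r subr0 in Xc.
    apply: no; exists c^-1; move: (XZ (- c^-1) _ Xc).
    by rewrite scalerBr scalerA mulNr mulVf // !scaleNr scale1r opprK addrC.
  have : R (exist _ Y (And3 sY (subset_trans WX XY) Yv))
           (exist _ X XP).
    by apply: Xmax; apply/asboolP.
  move=> /asboolP YX; apply: Xx; apply: YX.
  by exists 1; rewrite scale1r subrr.
have uniq x c d : X (x - c *: v) -> X (x - d *: v) -> c = d.
  move=> Xc Xd; apply/eqP/negPn/negP => cd.
  have := XB _ _ Xd Xc; rewrite opprB addrC addrA subrK -scalerBl => Xcd.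
  apply: Xv; have := XZ (c - d)^-1 _ Xcd.
  by rewrite scalerA mulVf ?scale1r // subr_eq0.
have [phi phiP] := choice coord.
have phi_lin : GRing.linear_for *%R phi.
  move=> c x y; apply: uniq (phiP _) _.
  have := Xl c _ _ (phiP x) (phiP y).
  by rewrite scalerBr scalerA addrACA -opprD -scalerDl.
pose l := GRing.isLinear.Build k V k^o *:%R phi phi_lin.
pose Phi : {linear V -> k^o} := HB.pack (phi : V -> k^o) l.
exists Phi; split=> [w Ww|] /=.
  by apply: uniq (phiP w) _; rewrite scale0r subr0; exact: WX.
by apply: uniq (phiP v) _; rewrite scale1r subrr.
Qed.

Section Tensor.
Variables (k : fieldType) (A B R : comAlgType k).
Variables (iA : {lrmorphism A -> R}) (iB : {lrmorphism B -> R}).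

Lemma is_tensor_product_sym :
  is_tensor_product iA iB -> is_tensor_product iB iA.
Proof.
move=> hR V f; pose f' a b := f b a.
have f'l : bilinear_for *:%R *:%R f'.
  split=> [b|a] c u v /=; rewrite /f'; [exact: linearP|].
  by rewrite linearPl.
pose i := bilinear_isBilinear.Build k A B V *:%R *:%R f' f'l.
pose F : {bilinear A -> B -> V} := HB.pack f' i.
have [g gE gU] := hR V F; exists g => [b a|g' g'E]; first by rewrite mulrC gE.
by apply: gU => a b; rewrite mulrC g'E.
Qed.

Hypothesis hR : is_tensor_product iA iB.

(** A linear form that kills all pure tensors is zero by the uniqueness clause, so their span is not
    a proper subspace. *)
Lemma tensor_span r : exists s : seq (A * B),
  r = \sum_(x <- s) iA x.1 * iB x.2.
Proof.
pose W := [set r | exists s : seq (A * B), r = \sum_(x <- s) iA x.1 * iB x.2].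
apply: contrapT => rW.
have [|phi [phiW phir]] := @separating_functional k R W r _ rW.
  split=> [|c _ _ [s ->] [t ->]]; first by exists [::]; rewrite big_nil.
  exists ([seq (c *: x.1, x.2) | x <- s] ++ t); rewrite big_cat big_map /=.
  rewrite scaler_sumr; congr (_ + _); apply: eq_bigr => x _.
  by rewrite linearZ scalerAl.
pose f (a : A) (b : B) : k^o := 0.
have fl : bilinear_for *:%R *:%R f.
  by split=> [b|a] c u v /=; rewrite /f scaler0 addr0.
pose i := bilinear_isBilinear.Build k A B k^o *:%R *:%R f fl.
pose F : {bilinear A -> B -> k^o} := HB.pack f i.
have [g gE gU] := hR F.
have e1 : phi =1 g.
  by apply: gU => a b; apply: phiW; exists [:: (a, b)]; rewrite big_seq1.
have zl : GRing.linear_for *:%R (fun _ : R => 0 : k^o).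
  by move=> c u v; rewrite scaler0 addr0.
pose z : {linear R -> k^o} := HB.pack (fun _ : R => 0 : k^o)
  (GRing.isLinear.Build k R k^o *:%R (fun _ : R => 0 : k^o) zl).
have e2 : z =1 g by exact: gU.
by have := oner_neq0 k; rewrite -phir e1 -e2 eqxx.
Qed.

(* The maps [id (x) phi : A (x) B -> A] with [phi] a linear form on [B]
   vanishing on [W]. *)
Definition contraction (W : set B) (g : R -> A) : Prop :=
  [/\ forall u v, g (u + v) = g u + g v,
      forall a r, g (iA a * r) = a * g r,
      forall b, exists c : k, g (iB b) = c%:A
    & forall b, W b -> g (iB b) = 0].

Lemma contraction_ex W b : subspace W -> ~ W b ->
  exists2 g, contraction W g & g (iB b) = 1.
Proof.
move=> sW Wb; have [phi [phiW phib]] := separating_functional sW Wb.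
pose f (a : A) (b : B) : A := phi b *: a.
have fl : bilinear_for *:%R *:%R f.
  split=> [b'|a] c u v /=; rewrite /f; first by rewrite scalerDr !scalerA mulrC.
  by rewrite linearP scalerDl scalerA.
pose i := bilinear_isBilinear.Build k A B A *:%R *:%R f fl.
pose F : {bilinear A -> B -> A} := HB.pack f i.
have [g gE _] := hR F.
have gB b' : g (iB b') = (phi b')%:A by rewrite -[iB b']mul1r -(rmorph1 iA) gE.
exists g; last by rewrite gB phib scale1r.
split=> [u v|a r|b'|b' Wb']; first exact: linearD.
- have [s ->] := tensor_span r; rewrite mulr_sumr !linear_sum mulr_sumr.
  by apply: eq_bigr => x _; rewrite mulrA -rmorphM /= !gE /= /f scalerAr.
- by exists (phi b').
- by rewrite gB phiW ?scale0r.
Qed.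

End Tensor.

(** * Membership in sums of extended ideals *)

Section Contractions.
Variables (k : fieldType) (A B R : comAlgType k).
Variables (iA : {lrmorphism A -> R}) (iB : {lrmorphism B -> R}).

Section ContractionTheory.
Variables (W : set B) (g : R -> A).
Hypothesis gW : contraction iA iB W g.

Lemma contractionD u v : g (u + v) = g u + g v.
Proof. by have [+ _ _ _] := gW; apply. Qed.

Lemma contractionM a r : g (iA a * r) = a * g r.
Proof. by have [_ + _ _] := gW; apply. Qed.

Lemma contraction_in b : exists c : k, g (iB b) = c%:A.
Proof. by have [_ _ + _] := gW; apply. Qed.

Lemma contraction_eq0 b : W b -> g (iB b) = 0.
Proof. by have [_ _ _] := gW; apply. Qed.

Lemma contraction0 : g 0 = 0.
Proof. by rewrite -(mulr0 (iA 0)) contractionM mul0r. Qed.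

Lemma contraction_sum (T : Type) (r : seq T) (F : T -> R) :
  g (\sum_(i <- r) F i) = \sum_(i <- r) g (F i).
Proof. exact: (big_morph g contractionD contraction0). Qed.

End ContractionTheory.

(** Since pure tensors span [R], this makes a condition imposed on all contractions stable under
    multiplication by [R]. *)
Lemma contraction_mulB (b : set B) g v : ideal b -> contraction iA iB b g ->
  contraction iA iB b (fun r => g (iB v * r)).
Proof.
move=> ib gb; split=> [u w|a r|c|c bc].
- by rewrite mulrDr (contractionD gb).
- by rewrite mulrCA (contractionM gb).
- by rewrite -rmorphM; exact: contraction_in gb _.
- by rewrite -rmorphM (contraction_eq0 gb) //; exact: idealMl.
Qed.

Lemma contractionS (W W' : set B) g : W `<=` W' ->
  contraction iA iB W' g -> contraction iA iB W g.
Proof. by move=> WW' [? ? ? h]; split=> // b /WW'; exact: h. Qed.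

Definition ext_add (a : set A) (b : set B) : set R :=
  ideal_add (extension iA a) (extension iB b).

Lemma ext_add_ideal a b : ideal (ext_add a b).
Proof. by apply: ideal_add_ideal; exact: ideal_gen_ideal. Qed.

Lemma ext_addl (a : set A) b x : a x -> ext_add a b (iA x).
Proof.
move=> ax; apply: ideal_addl; first exact: ideal_gen_ideal.
by apply: mem_ideal_gen; exists x.
Qed.

Lemma ext_addr a (b : set B) x : b x -> ext_add a b (iB x).
Proof.
move=> bx; apply: ideal_addr; first exact: ideal_gen_ideal.
by apply: mem_ideal_gen; exists x.
Qed.

Lemma ext_add_sub a b (L : set R) : ideal L ->
  (forall x, a x -> L (iA x)) -> (forall x, b x -> L (iB x)) ->
  ext_add a b `<=` L.
Proof.
move=> iL aL bL; apply: ideal_add_sub => //.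
  by apply: ideal_gen_sub => // _ [x ax <-]; exact: aL.
by apply: ideal_gen_sub => // _ [x bx <-]; exact: bL.
Qed.

Lemma ext_repr (X : set A) z : extension iA X z ->
  exists n (a : 'I_n -> A) (w : 'I_n -> R),
    (forall i, X (a i)) /\ z = \sum_i iA (a i) * w i.
Proof.
pose Y := [set z | exists2 s : seq (A * R), (forall x, x \in s -> X x.1) &
  z = \sum_(x <- s) iA x.1 * x.2].
have sub : extension iA X `<=` Y.
  apply: ideal_gen_sub => [|_ [a Xa <-]]; last first.
    exists [:: (a, 1)]; first by move=> x; rewrite inE => /eqP->.
    by rewrite big_seq1 mulr1.
  split=> [|c _ _ [s sX ->] [t tX ->]]; first by exists [::]; rewrite ?big_nil.
  exists ([seq (x.1, c * x.2) | x <- s] ++ t).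
    move=> x; rewrite mem_cat => /orP[/mapP[y ys ->]|/tX//]; exact: (sX y).
  rewrite big_cat big_map mulr_sumr; congr (_ + _).
  by apply: eq_bigr => x _; rewrite /= mulrCA.
move=> /sub[s sX ->].
exists (size s), (fun i => (nth (0, 0) s i).1), (fun i => (nth (0, 0) s i).2).
split=> [i|]; first by apply: sX; exact: mem_nth.
by rewrite (big_nth (0, 0)) big_mkord.
Qed.

(* A representation of minimal length of an element of [Z]: a dependence
   relation with a coefficient [c] outside [p] would shorten it after
   multiplication by [c]. *)
Lemma independent_repr (C a p X : set A) (D Z : set R) n
    (x : 'I_n -> A) (w : 'I_n -> R) :
  (forall c c' u v, C c -> C c' -> D u -> D v -> D (iA c * u - iA c' * v)) ->
  (forall z b r, Z z -> a b -> Z (z - iA b * r)) ->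
  (forall c z, C c -> ~ p c -> Z z -> Z (iA c * z)) ->
  (forall i, X (x i)) -> (forall i, D (w i)) -> Z (\sum_i iA (x i) * w i) ->
  exists n' (x' : 'I_n' -> A) (w' : 'I_n' -> R),
    [/\ forall i, X (x' i), forall i, D (w' i), Z (\sum_i iA (x' i) * w' i)
      & forall c : 'I_n' -> A, (forall i, C (c i)) ->
          a (\sum_i c i * x' i) -> forall i, p (c i)].
Proof.
move=> DC Za ZC; elim: n x w => [|n IH] x w Xx Dw Zxw.
  by exists 0%N, x, w; split=> // c _ _ [].
have [?|] := pselect (forall c : 'I_n.+1 -> A, (forall i, C (c i)) ->
          a (\sum_i c i * x i) -> forall i, p (c i));
            first by exists n.+1, x, w.
move=> /existsNP[c /not_implyP[Cc /not_implyP[ac /existsNP[i0 pc]]]].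
pose w' i := iA (c i0) * w i - iA (c i) * w i0.
apply: (IH (fun i => x (lift i0 i)) (fun i => w' (lift i0 i))) => [i|i|].
- exact: Xx.
- exact: DC.
suff -> : \sum_(i < n) iA (x (lift i0 i)) * w' (lift i0 i) =
  iA (c i0) * (\sum_i iA (x i) * w i) - iA (\sum_i c i * x i) * w i0.
  by apply: Za => //; exact: ZC.
transitivity (\sum_i iA (x i) * w' i).
  by rewrite (bigD1_ord i0) //= {2}/w' subrr mulr0 add0r.
rewrite mulr_sumr linear_sum mulr_suml -sumrB; apply: eq_bigr => i _.
by rewrite /w' rmorphM; ring.
Qed.

Hypothesis hR : is_tensor_product iA iB.

Section Span.
Variable b : set B.
Hypothesis ib : ideal b.

(** The subspace of [B] spanned by [b] and the second components of [s]. *)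
Fixpoint span_mod (s : seq (A * B)) : set B :=
  if s is x :: s' then [set v | exists c : k, span_mod s' (v - c *: x.2)]
  else b.

Lemma span_mod_subspace s : subspace (span_mod s).
Proof.
elim: s => [|x s [s0 sl]] /=; first exact: ideal_subspace.
split=> [|c u v [d hu] [e hv]]; first by exists 0; rewrite scale0r subr0.
exists (c * d + e); have := sl c _ _ hu hv.
by rewrite scalerBr scalerA addrACA -opprD -scalerDl.
Qed.

Lemma sub_span_mod s : b `<=` span_mod s.
Proof.
elim: s => //= x s IH v bv; exists 0; rewrite scale0r subr0; exact: IH.
Qed.

Lemma mem_span_mod s x : x \in s -> span_mod s x.2.
Proof.
elim: s => // y s IH; rewrite inE => /orP[/eqP->|/IH xs] /=.
  exists 1; rewrite scale1r subrr; exact: (span_mod_subspace s).1.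
by exists 0; rewrite scale0r subr0.
Qed.

(** Expanding [v] over the second components of [s] modulo [b] distributes the tensor of [a] and [v]
    over the first components, without lengthening the sum. *)
Lemma span_mod_absorb s a v (X : set B) : span_mod s v ->
  (forall x, x \in s -> X x.2) -> exists s' : seq (A * B),
  [/\ size s' = size s, forall x, x \in s' -> X x.2 &
   extension iB b (iA a * iB v + \sum_(x <- s) iA x.1 * iB x.2
                   - \sum_(x <- s') iA x.1 * iB x.2)].
Proof.
elim: s v => [|x s IH] v /=.
  move=> bv _; exists [::]; split=> //; rewrite !big_nil addr0 subr0.
  by apply: (idealMl _ (ideal_gen_ideal _)); apply: mem_ideal_gen; exists v.
move=> [c /IH sv] sX; have [|s' [sz s'X s'E]] := sv _.
  by move=> y ys; apply: sX; rewrite inE ys orbT.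
exists ((x.1 + c *: a, x.2) :: s'); split=> [|y|]; first by rewrite /= sz.
  by rewrite inE => /orP[/eqP->|/s'X//]; exact: (sX x (mem_head _ _)).
rewrite !big_cons /=; move: s'E; congr (extension _ _ _).
rewrite linearB (linearD iA) !linearZ /= scalerN.
rewrite mulrBr mulrDl -scalerAl -scalerAr; ring.
Qed.

(** Induction on the length of [s]. If [b0] depends on the other second components modulo [b], its
    term is absorbed; otherwise a contraction with value 1 at [b0] and 0 at the others extracts
    [a0], which thus lies in [a]. Second components stay in [X], whence the product ideal. *)
Lemma contraction_mem_seq (a : set A) (X : set B) s : ideal a -> ideal X ->
  (forall x, x \in s -> X x.2) ->
  (forall g, contraction iA iB b g -> a (g (\sum_(x <- s) iA x.1 * iB x.2))) ->
  ideal_add (ideal_mul (extension iA a) (extension iB X)) (extension iB b)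
    (\sum_(x <- s) iA x.1 * iB x.2).
Proof.
move=> ia iX; set K := ideal_add _ _.
have iK : ideal K by apply: ideal_add_ideal; exact: ideal_gen_ideal.
have bK : extension iB b `<=` K.
  by move=> z bz; apply: ideal_addr => //; exact: ideal_gen_ideal.
have [m] := ubnP (size s); elim: m s => // m IH [|[a0 b0] s] sm sX sa.
  by rewrite big_nil; exact: ideal0.
have sX' x : x \in s -> X x.2 by move=> xs; apply: sX; rewrite inE xs orbT.
rewrite big_cons /=; have [b0s|b0s] := pselect (span_mod s b0).
  have [s' [sz s'X s'E]] := span_mod_absorb a0 b0s sX'.
  rewrite -(subrK (\sum_(x <- s') iA x.1 * iB x.2) (_ + _)).
  apply: idealD => //; first exact: bK.
  apply: IH => // [|g gb]; first by rewrite sz.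
  have := sa g gb; rewrite big_cons /=.
  rewrite -{1}(subrK (\sum_(x <- s') iA x.1 * iB x.2) (_ + _)).
  rewrite (contractionD gb); set t := g (_ - _).
  suff -> : t = 0 by rewrite add0r.
  (* Contractions vanish on the extension of [b], so they do not see the passage from [s] to
     [s']. *)
  suff h : extension iB b `<=` [set z | forall g, contraction iA iB b g -> g z
    = 0].
    exact: h s'E _ gb.
  apply: ideal_gen_sub => [|_ [v bv <-] h hb];
    last exact: contraction_eq0 hb _ bv.
  split=> [h hb|c u v hu hv h hb]; first exact: contraction0 hb.
  rewrite (contractionD hb) hv // addr0.
  have [t' ->] := tensor_span hR c; rewrite mulr_suml (contraction_sum hb).
  rewrite big1 // => x _; rewrite -mulrA (contractionM hb).
  by rewrite (hu _ (contraction_mulB _ ib hb)) mulr0.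
have [g gs gb0] := contraction_ex hR (span_mod_subspace s) b0s.
have gb := contractionS (@sub_span_mod s) gs.
have ga0 : g (\sum_(x <- (a0, b0) :: s) iA x.1 * iB x.2) = a0.
  rewrite big_cons (contractionD gs) (contractionM gs) /= gb0 mulr1.
  rewrite (contraction_sum gs) big_seq big1 ?addr0 // => x xs.
  by rewrite (contractionM gs) (contraction_eq0 gs (mem_span_mod xs)) mulr0.
have aa0 : a a0 by rewrite -ga0; exact: sa.
apply: idealD => //.
  apply: ideal_addl; first exact: ideal_gen_ideal.
  apply: mem_ideal_mul; apply: mem_ideal_gen; first by exists a0.
  by exists b0 => //; apply: (sX (a0, b0)); rewrite mem_head.
apply: IH => // h hb; have := sa h hb.
rewrite big_cons (contractionD hb); apply: idealDl => //.
by rewrite (contractionM hb) /=; exact: idealMr.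
Qed.

(** One direction is [contraction_mem_seq] with [X] all of [B]. For the other, the elements whose
    contractions all lie in [a] form an ideal by [contraction_mulB]. *)
Lemma ext_addP (a : set A) z : ideal a ->
  ext_add a b z <-> forall g, contraction iA iB b g -> a (g z).
Proof.
move=> ia; split=> [|h]; last first.
  have [s zE] := tensor_span hR z.
  have [||u hu [v hv e]] :=
      @contraction_mem_seq a [set: B] s ia (@idealT _).
  - by [].
  - by rewrite -zE.
  exists u; last by exists v => //; rewrite zE.
  move: hu; apply: ideal_mul_sub => [|x y ax _]; first exact: ideal_gen_ideal.
  exact: (idealMr _ (ideal_gen_ideal _)).
move: z; apply: ext_add_sub => [|x ax g gb|x bx g gb].
- split=> [g gb|c u v hu hv g gb]; first by rewrite (contraction0 gb);
  exact: ideal0.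
  rewrite (contractionD gb); apply: idealD => //; last exact: hv.
  have [s ->] := tensor_span hR c; rewrite mulr_suml (contraction_sum gb).
  apply: ideal_sum => // x _; rewrite -mulrA (contractionM gb).
  by apply: idealMl => //; exact: hu (contraction_mulB _ ib gb).
- by rewrite -[iA x]mulr1 (contractionM gb); exact: idealMr.
- by rewrite (contraction_eq0 gb bx); exact: ideal0.
Qed.

End Span.
End Contractions.

(** * Associated primes and powers of a sum of extended ideals *)

Lemma ext_exp_sub (S T : comNzRingType) (f : {rmorphism S -> T}) (I : set S) n :
  ideal_exp (extension f I) n `<=` extension f (ideal_exp I n).
Proof.
elim: n => [|n IH].
  move=> x _; rewrite -[x]mulr1; apply: (idealMl _ (ideal_gen_ideal _)).
  by apply: mem_ideal_gen; exists 1; rewrite ?rmorph1.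
pose E := extension f (ideal_exp I n.+1).
have iE : ideal E by exact: ideal_gen_ideal.
apply: ideal_mul_sub => // x y + /IH; move: x.
suff h : extension f I `<=`
    [set x | forall y, extension f (ideal_exp I n) y -> E (x * y)].
  by move=> x /h; exact.
apply: ideal_gen_sub => [|_ [u Iu <-] z]; first exact: ideal_colon.
suff h : extension f (ideal_exp I n) `<=`
    [set y | forall t, t = f u -> E (y * t)].
  by move=> /h /(_ _ erefl); rewrite mulrC.
apply: ideal_gen_sub => [|_ [v Iv <-] _ ->];
  first exact: (ideal_colon [set t | t = f u]).
by apply: mem_ideal_gen; exists (u * v);
  [exact: mem_ideal_mul|rewrite mulrC rmorphM].
Qed.

Lemma exp_ext (S T : comNzRingType) (f : {rmorphism S -> T}) (I : set S)
    (Q : set T) n x : ideal Q -> (forall u, I u -> Q (f u)) ->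
  ideal_exp I n x -> ideal_exp Q n (f x).
Proof.
move=> iQ IQ; elim: n x => // n IH.
have iE := @ideal_exp_ideal T Q n.+1.
apply: ideal_mul_sub => [|u v /IQ Qu /IH Qv].
  split=> [|a u v hu hv] /=; first by rewrite rmorph0; exact: ideal0.
  by rewrite rmorphD rmorphM; exact: iE.2.
by rewrite rmorphM; exact: mem_ideal_mul.
Qed.

Lemma prime_preim_ex (S T : comNzRingType) (f : {rmorphism S -> T})
    (P : prime_idealr T) :
  exists q : prime_idealr S, [set` q] = [set a | f a \in P].
Proof.
apply: prime_set_ex; split=> [||a b /=].
- split=> [|a u v /=]; first by rewrite /= rmorph0 rpred0.
  by rewrite rmorphD rmorphM => uP vP; rewrite rpredD // prime_idealrM uP orbT.
- by rewrite /= rmorph1 idealr1.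
- by rewrite rmorphM prime_idealrM => /orP.
Qed.

Section Sums.
Variables (k : fieldType) (A B R : comAlgType k).
Variables (iA : {lrmorphism A -> R}) (iB : {lrmorphism B -> R}).
Hypothesis hR : is_tensor_product iA iB.

Local Notation K := (ext_add iA iB).

Lemma ext_repr_seq (X : set B) z : ideal X -> extension iB X z ->
  exists2 s : seq (A * B), (forall x, x \in s -> X x.2) &
    z = \sum_(x <- s) iA x.1 * iB x.2.
Proof.
move=> iX; move: z; apply: ideal_gen_sub => [|_ [b Xb <-]]; last first.
  exists [:: (1, b)]; first by move=> x; rewrite inE => /eqP->.
  by rewrite big_seq1 rmorph1 mul1r.
split=> [|c _ _ [s sX ->] [t tX ->]]; first by exists [::]; rewrite ?big_nil.
have [r ->] := tensor_span hR c.
exists ([seq (y.1 * x.1, y.2 * x.2) | y <- r, x <- s] ++ t).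
  move=> x; rewrite mem_cat => /orP[|/tX//].
  by move=> /allpairsP[[y y'] [/= yr ys ->]]; apply: idealMl => //;
    exact: (sX y').
rewrite big_cat big_allpairs_dep mulr_suml; congr (_ + _).
apply: eq_bigr => y _; rewrite mulr_sumr; apply: eq_bigr => x _ /=.
by rewrite !rmorphM; ring.
Qed.

(** Contractions are [A]-linear, so [s] cancels modulo the prime [p]. *)
Lemma ext_add_regular (p : prime_idealr A) b s z : ideal b -> s \notin p ->
  K [set` p] b (iA s * z) -> K [set` p] b z.
Proof.
move=> ib sp; have ip := idealr_ideal p.
move=> /(ext_addP hR ib _ ip) h; apply/(ext_addP hR ib _ ip) => g gb.
have := h g gb; rewrite (contractionM gb) /= prime_idealrM.
by rewrite (negbTE sp).
Qed.

(** Some [u s^m] with [u] outside [P] lies in [K(p, b)]. For [s] outside [p] the power [s^m] is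
    regular modulo [K(p, b)], which would put [u] in [P]. *)
Lemma minimal_prime_preim (p : prime_idealr A) b (P : prime_idealr R) s :
  noetherian R -> ideal b -> minimal_prime (K [set` p] b) P ->
  iA s \in P -> s \in p.
Proof.
move=> noeth ib Pmin sP; apply: contraT => sp.
have [m [u uP]] := minimal_prime_nilp noeth (ext_add_ideal _ _ _ _) Pmin sP.
rewrite mulrC -rmorphXn => /ext_add_regular h; case/negP: uP.
apply: Pmin.1; apply: h => //.
by elim: m => [|m IH]; rewrite ?expr0 ?idealr1 // exprS prime_idealrM negb_or
  sp.
Qed.

(** The contraction of [P] to [A] contains a minimal prime [p] of [I], and [P] remains minimal over
    [K(p, J)], so [minimal_prime_preim] applies. *)
Lemma minimal_prime_contract (I : set A) (J : set B) (P : prime_idealr R) :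
  noetherian R -> ideal J -> minimal_prime (K I J) P ->
  exists2 p : prime_idealr A, minimal_prime I p &
    forall s, iA s \in P -> s \in p.
Proof.
move=> noeth iJ [KP Pmin].
have [q qE] := prime_preim_ex iA P.
have [|p pmin pq] := @minimal_prime_ex _ I q.
  by rewrite qE => a Ia; apply: KP; exact: ext_addl.
exists p => // s; apply: (@minimal_prime_preim _ J) => //.
split=> [|P' KP' P'P].
  apply: ext_add_sub => [|a /pq|b Jb]; first exact: idealr_ideal.
    by rewrite qE.
  by apply: KP; exact: ext_addr.
apply: Pmin => //; apply: subset_trans KP'; apply: ext_add_sub.
- exact: ext_add_ideal.
- by move=> x Ix; apply: ext_addl; exact: pmin.1.
- by move=> x Jx; exact: ext_addr.
Qed.

(* Let [p] be maximal among the annihilators of counterexamples.  In a shortest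
   representation of a counterexample by elements annihilated by [p] modulo [a],
   these elements are independent over [A / p], so [Hp] applies to their
   cofactors. *)
Lemma colon_ext_add (a : set A) b (L : set R) :
  noetherian A -> ideal a -> ideal b ->
  (forall p : prime_idealr A, a `<=` [set` p] ->
    (exists2 x, ~ a x & forall s, s \in p -> a (s * x)) ->
    forall w, (forall l, L l -> K [set` p] b (l * w)) -> K [set` p] b w) ->
  forall z, (forall l, L l -> K a b (l * z)) -> K a b z.
Proof.
move=> noeth ia ib Hp z Lz; apply: contrapT => Kz.
have iK := ext_add_ideal iA iB a b.
pose ann z := [set s | K a b (iA s * z)].
have iann y : ideal (ann y).
  split=> [|c u v hu hv] /=; first by rewrite /ann /= rmorph0 mul0r;
    exact: ideal0.
  by rewrite /ann /= rmorphD rmorphM mulrDl -mulrA; exact: iK.2.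
have [||_ [y Ly [Ky ->]] ymax] := @noetherian_max A
  (fun X => exists2 y, forall l, L l -> K a b (l * y) & ~ K a b y /\ X = ann y)
    noeth.
- by move=> _ [y _ [_ ->]].
- by exists (ann z), z.
(* By maximality, multiples of [y] outside [K a b] have the same annihilator; hence [ann y] is
   prime. *)
have annM t : ~ ann y t -> ann (iA t * y) = ann y.
  move=> yt; have sub : ann y `<=` ann (iA t * y).
    by move=> s ys; rewrite /ann /= mulrCA; exact: idealMl.
  apply/seteqP; split=> //; apply: ymax => //; exists (iA t * y) => //.
  by move=> l /Ly Kl; rewrite mulrCA; exact: idealMl.
have [p pE] : exists p : prime_idealr A, [set` p] = ann y.
  apply: prime_set_ex; split=> //; first by rewrite /ann /= rmorph1 mul1r.
  move=> s t yst; have [|yt] := pselect (ann y t); first by right.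
  by left; rewrite -(annM _ yt) /ann /= mulrA -rmorphM.
have ip := idealr_ideal p.
have ap : a `<=` [set` p].
  move=> s; rewrite pE => as_; rewrite /ann /=; apply: idealMr => //.
  exact: ext_addl.
pose c := [set x | forall s, [set` p] s -> a (x * s)].
have ic : ideal c by exact: ideal_colon.
have cy g : contraction iA iB b g -> c (g y).
  move=> gb s; rewrite pE /ann /= => /(ext_addP hR ib _ ia) /(_ _ gb).
  by rewrite (contractionM gb) mulrC.
have /(ext_addP hR ib _ ic) : forall g, contraction iA iB b g -> c (g y) by [].
move=> [y1 /ext_repr[n [x [w [xc y1E]]]] [y2 by2 yE]].
have Ky2 r : K a b (r * y2).
  by apply: idealMl => //; apply: ideal_addr => //; exact: ideal_gen_ideal.
(* The properties of [y] that survive the shortening in [independent_repr]: subtracting elements of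
   [K a b] and multiplying by elements outside [p] preserve both. *)
pose Z := [set v | (forall l, L l -> K a b (l * v)) /\ ann v = ann y].
have ZB v t : Z v -> K a b t -> Z (v - t).
  move=> [Lv av] Kt; split=> [l Ll|].
    by rewrite mulrBr; apply: idealB => //; [exact: Lv|exact: idealMl].
  rewrite -av; apply/seteqP; split=> s; rewrite /ann /= mulrBr => h.
    by rewrite -(subrK (iA s * t) (_ * _)); apply: idealD => //; exact: idealMl.
  by apply: idealB => //; exact: idealMl.
have [||||||n' [x' [w' [x'c _ [Lv av] indep]]]] :=
  @independent_repr k A R iA [set: A] a [set` p] c [set: R] Z n x w.
- by [].
- move=> v s r Zv as_; apply: ZB => //; apply: idealMr => //; exact: ext_addl.
- move=> s v _ ps [Lv av]; split.
    by move=> l /Lv h; rewrite mulrCA; exact: idealMl.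
  rewrite -[RHS](annM s); last by rewrite -pE.
  have annE u t : ann (iA s * u) t = ann u (t * s).
    by rewrite /ann /= mulrA -rmorphM.
  by apply/seteqP; split=> t; rewrite !annE av.
- exact: xc.
- by [].
- rewrite -y1E -[y1](addrK y2) yE; apply: ZB; first by split.
  by rewrite -[y2]mul1r; exact: Ky2.
move: Lv av indep; set v := \sum_i _ => Lv av indep.
have vK : ~ K a b v.
  move=> Kv; have : ann v 1 by rewrite /ann /= rmorph1 mul1r.
  by rewrite av /ann /= rmorph1 mul1r.
apply: vK; rewrite /v; apply: ideal_sum => // i _.
(* Contracting [l * v] gives a relation between the [x' j] with coefficients [g (l * w' j)];
   independence puts these in [p], so that [Hp] applies. Then [x' i] carries [p] into [a]. *)
have : K [set` p] b (w' i).
  apply: Hp => //.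
    have [x0 x0P] : exists x0, ~ a x0 /\ c x0.
      apply: contrapT => no; apply: Ky; apply/(ext_addP hR ib _ ia) => g gb.
      by apply: contrapT => ag; apply: no; exists (g y); split; [|exact: cy].
    by exists x0 => [|s sp]; [exact: x0P.1|rewrite mulrC; exact: x0P.2].
  move=> l /Lv lv; apply/(ext_addP hR ib _ ip) => g gb.
  apply: (indep (fun j => g (l * w' j))) => //.
  have := lv; rewrite mulr_sumr => /(ext_addP hR ib _ ia) /(_ _ gb).
  rewrite (contraction_sum gb); congr a; apply: eq_bigr => j _.
  by rewrite mulrCA (contractionM gb) mulrC.
move=> /(ext_addP hR ib _ ip) h; apply/(ext_addP hR ib _ ia) => g gb.
by rewrite (contractionM gb); apply: x'c; exact: h.
Qed.

(** [z] has a representation with second components in [a], which [contraction_mem_seq]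
    preserves. *)
Lemma ext_inter_ext_add (a a' : set B) (b : set A) z :
  ideal a -> ideal a' -> ideal b -> extension iB a z -> K b a' z ->
  ideal_add (ideal_mul (extension iA b) (extension iB a)) (extension iB a') z.
Proof.
move=> ia ia' ib /(ext_repr_seq ia)[s sa ->] /(ext_addP hR ia' _ ib).
exact: contraction_mem_seq.
Qed.

Lemma exp_ext_add_sub (I : set A) (J : set B) i j n : (i + j <= n.+1)%N ->
  ideal_exp (K I J) n `<=` K (ideal_exp I i) (ideal_exp J j).
Proof.
move=> ijn y Qy; have [|||u hu [v hv <-]] :=
  @ideal_exp_add_sub R (extension iA I)
  (extension iB J) i j n _ _ _ y Qy; try exact: ideal_gen_ideal; first by [].
by exists u; [exact: ext_exp_sub|exists v => //; exact: ext_exp_sub].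
Qed.

(** By induction on [m], [z] lies in [Q^n + J^m R]: the remainder in [J^m R] also lies in
    [K(I^{n-m}, J^{m+1})], hence in [I^{n-m} J^m R + J^{m+1} R], and the first summand is inside
    [Q^n]. At [m = n] the remainder itself is in [Q^n]. *)
Lemma inter_ext_add (I : set A) (J : set B) n z : ideal I -> ideal J ->
  (forall i, (0 < i <= n)%N -> K (ideal_exp I i) (ideal_exp J (n.+1 - i)) z) ->
  ideal_exp (K I J) n z.
Proof.
move=> iI iJ h; set Q := K I J.
have iQ : ideal Q by exact: ext_add_ideal.
have iE i : ideal (ideal_exp Q i) by exact: ideal_exp_ideal.
have QI i x : ideal_exp I i x -> ideal_exp Q i (iA x).
  by apply: exp_ext => // u; exact: ext_addl.
have QJ i x : ideal_exp J i x -> ideal_exp Q i (iB x).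
  by apply: exp_ext => // u; exact: ext_addr.
have QJe i : extension iB (ideal_exp J i) `<=` ideal_exp Q i.
  by apply: ideal_gen_sub => // _ [x Jx <-]; exact: QJ.
have QIe i : extension iA (ideal_exp I i) `<=` ideal_exp Q i.
  by apply: ideal_gen_sub => // _ [x Jx <-]; exact: QI.
have claim m : (m <= n)%N ->
    ideal_add (ideal_exp Q n) (extension iB (ideal_exp J m)) z.
  elim: m => [|m IH] mn.
    apply: ideal_addr => //; rewrite -[z]mulr1.
    apply: (idealMl _ (ideal_gen_ideal _)); apply: mem_ideal_gen.
    by exists 1; rewrite ?rmorph1.
  have [y Qy [w Jw zE]] := IH (ltnW mn).
  have : K (ideal_exp I (n - m)) (ideal_exp J m.+1) w.
    have iK := ext_add_ideal iA iB (ideal_exp I (n - m)) (ideal_exp J m.+1).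
    apply: (idealDl (u := y)) => //; last first.
      rewrite zE; have := h (n - m)%N; rewrite subn_gt0 mn leq_subr => /(_ isT).
      by rewrite subSn ?leq_subr // subKn // ltnW.
    by move: Qy; apply: exp_ext_add_sub; rewrite addnS subnK // ltnW.
  move=> /ext_inter_ext_add H.
  have [|||u hu [v hv uv]] := H (ideal_exp J m) _ _ _ Jw;
    try exact: ideal_exp_ideal.
  exists (y + u); last by exists v => //; rewrite -addrA uv.
  apply: idealD => //; move: hu; apply: ideal_mul_sub => // c d /QIe hc /QJe hd.
  by rewrite -(subnK (ltnW mn)); exact: ideal_expM.
have [y Qy [w /QJe Qw <-]] := claim n (leqnn n); exact: idealD.
Qed.

End Sums.

(** * Elements algebraic over a domain *)

Section AlgebraicElements.
Variables (R : comNzRingType) (D E : set R).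

Definition subring_set : Prop :=
  [/\ D 1, forall u v, D u -> D v -> D (u - v)
    & forall u v, D u -> D v -> D (u * v)].

Hypothesis sD : subring_set.
Hypothesis iE : ideal E.
Hypothesis E1 : ~ E 1.
Hypothesis domE : forall u v, D u -> D v -> E (u * v) -> E u \/ E v.

Lemma subring_set1 : D 1. Proof. by case: sD. Qed.
Lemma subring_setB u v : D u -> D v -> D (u - v).
Proof. by case: sD => _ h _; exact: h. Qed.
Lemma subring_setM u v : D u -> D v -> D (u * v).
Proof. by case: sD => _ _ h; exact: h. Qed.
Lemma subring_set0 : D 0.
Proof. by rewrite -(subrr 1); apply: subring_setB; exact: subring_set1. Qed.
Lemma subring_setN u : D u -> D (- u).
Proof. by rewrite -sub0r; apply: subring_setB; exact: subring_set0. Qed.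
Lemma subring_setD u v : D u -> D v -> D (u + v).
Proof. by move=> Du Dv; rewrite -[v]opprK; apply: subring_setB => //;
  exact: subring_setN. Qed.
Lemma subring_set_sum (T : Type) (r : seq T) (P : pred T) (F : T -> R) :
  (forall i, P i -> D (F i)) -> D (\sum_(i <- r | P i) F i).
Proof.
move=> DF; elim/big_ind: _ => //; first exact: subring_set0.
exact: subring_setD.
Qed.

(* The preimages in [R] of the subspaces of [R / E] localized at the nonzero
   elements of the domain [D / (D /\ E)]. *)
Definition saturated (N : set R) : Prop :=
  [/\ E `<=` N, forall u v, N u -> N v -> N (u + v),
      forall d u, D d -> N u -> N (d * u)
    & forall d u, D d -> ~ E d -> N (d * u) -> N u].

Fixpoint lin_span (M : seq R) : set R :=
  if M is m :: M' then [set v | exists2 c, D c & lin_span M' (v - c * m)]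
  else E.

(** The preimage in [R] of the span of [M] over the fraction field of [D / (D /\ E)], with
    denominators cleared. *)
Definition frac_span (M : seq R) : set R :=
  [set v | exists d, [/\ D d, ~ E d & lin_span M (d * v)]].

Lemma lin_spanE M : E `<=` lin_span M.
Proof.
elim: M => //= m M IH v Ev; exists 0; first exact: subring_set0.
by rewrite mul0r subr0; exact: IH.
Qed.

Lemma lin_spanD M u v : lin_span M u -> lin_span M v -> lin_span M (u + v).
Proof.
elim: M u v => [|m M IH] u v /=; first exact: idealD.
move=> [c Dc hu] [d Dd hv]; exists (c + d); first exact: subring_setD.
by have := IH _ _ hu hv; rewrite addrACA -opprD -mulrDl.
Qed.

Lemma lin_spanM M d u : D d -> lin_span M u -> lin_span M (d * u).
Proof.
move=> Dd; elim: M u => [|m M IH] u /=; first exact: idealMl.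
move=> [c Dc hu]; exists (d * c); first exact: subring_setM.
by have := IH _ hu; rewrite mulrBr mulrA.
Qed.

Lemma notinE_mul u v : D u -> D v -> ~ E u -> ~ E v -> ~ E (u * v).
Proof. by move=> Du Dv Eu Ev /domE[]. Qed.

Lemma saturated_frac_span M : saturated (frac_span M).
Proof.
split.
- by move=> v Ev; exists 1; split=> //; [exact: subring_set1|rewrite mul1r;
  exact: lin_spanE].
- move=> u v [c [Dc Ec hu]] [d [Dd Ed hv]]; exists (c * d); split.
  + exact: subring_setM.
  + exact: notinE_mul.
  + rewrite mulrDr {1}[c * d]mulrC -2!mulrA.
    by apply: lin_spanD; exact: lin_spanM.
- move=> c u Dc [d [Dd Ed hu]]; exists d; split=> //.
  by rewrite mulrCA; exact: lin_spanM.
- move=> c u Dc Ec [d [Dd Ed hu]]; exists (d * c); rewrite -mulrA; split=> //.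
    exact: subring_setM.
  exact: notinE_mul.
Qed.

Lemma mem_frac_span M m : m \in M -> frac_span M m.
Proof.
move=> mM; exists 1; split=> //; first exact: subring_set1.
rewrite mul1r; elim: M mM => // x M IH; rewrite inE => /orP[/eqP->|/IH xs] /=.
  by exists 1; [exact: subring_set1|rewrite mul1r subrr; apply: lin_spanE;
    exact: ideal0].
by exists 0; [exact: subring_set0|rewrite mul0r subr0].
Qed.

Lemma frac_span_min M N : saturated N -> (forall m, m \in M -> N m) ->
  frac_span M `<=` N.
Proof.
move=> [NE ND NM Nd] NmM v [d [Dd Ed hv]]; apply: (Nd d) => //.
elim: M NmM (d * v) hv => [|m M IH] NmM u /=; first exact: NE.
move=> [c Dc hu]; rewrite -(subrK (c * m) u); apply: ND.
  by apply: IH => // x xM; apply: NmM; rewrite inE xM orbT.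
by apply: NM => //; apply: NmM; rewrite mem_head.
Qed.

(** Together with [frac_span_min] it reduces the effect of multiplication by [z] on a span to its
    generators. *)
Lemma saturated_preim N z : saturated N -> saturated [set v | N (z * v)].
Proof.
move=> [NE ND NM Nd]; split=> /=.
- by move=> v Ev; apply: NE; exact: idealMl.
- by move=> u v; rewrite mulrDr; exact: ND.
- by move=> d u Dd; rewrite mulrCA; exact: NM.
- by move=> d u Dd Ed; rewrite mulrCA; exact: Nd.
Qed.

(** Gaussian elimination with denominators cleared; each step eliminates one spanning element and
    one vector. *)
Lemma frac_span_dep M (z : 'I_(size M).+1 -> R) :
  (forall i, frac_span M (z i)) ->
  exists e : 'I_(size M).+1 -> R, [/\ forall i, D (e i),
    E (\sum_i e i * z i) & exists i, ~ E (e i)].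
Proof.
elim: M z => [|m M IH] z hz.
  have [d [Dd Ed dz]] := hz ord0.
  by exists (fun=> d); split=> //; [rewrite big_ord1|exists ord0].
have zP i : exists dc : R * R,
    [/\ D dc.1, ~ E dc.1, D dc.2 & lin_span M (dc.1 * z i - dc.2 * m)].
  by have [d [Dd Ed [c Dc h]]] := hz i; exists (d, c).
have [dc dcP] := choice zP; pose d i := (dc i).1; pose c i := (dc i).2.
have Dd i : D (d i) by have [] := dcP i.
have Ed i : ~ E (d i) by have [] := dcP i.
have Dc i : D (c i) by have [] := dcP i.
have hd i : lin_span M (d i * z i - c i * m) by have [] := dcP i.
have glue i0 (e0 : R) (e : 'I_(size M).+1 -> R) :
    exists e' : 'I_(size M).+2 -> R, e' i0 = e0 /\
      forall i, e' (lift i0 i) = e i.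
  exists (fun j => if unlift i0 j is Some i then e i else e0).
  by split=> [|i]; rewrite ?unlift_none ?liftK.
(* If [m] never occurs modulo [E], the first vector is dropped and receives coefficient 0. *)
have [cE|] := pselect (forall i, E (c i)).
  have [|e [De Ee [i ei]]] := IH (fun i => z (lift ord0 i)).
    move=> i; exists (d (lift ord0 i)); split=> //.
    rewrite -(subrK (c (lift ord0 i) * m) (_ * _)); apply: lin_spanD => //.
    by apply: lin_spanE; exact: idealMr.
  have [e' [e'0 e'S]] := glue ord0 0 e; exists e'; split.
  - by move=> j; case: (unliftP ord0 j) => [j'|] ->; rewrite ?e'0 ?e'S //;
    exact: subring_set0.
  - rewrite (bigD1_ord ord0) //= e'0 mul0r add0r.
    by under eq_bigr do rewrite e'S.
  - by exists (lift ord0 i); rewrite e'S.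
move=> /existsNP[i0 ci0].
(* Cross-multiplication with the pivot [i0] cancels [m]; the coefficient of the pivot later collects
   the multiples of [z i0] introduced here. *)
pose z' i := c i0 * (d (lift i0 i) * z (lift i0 i))
             - c (lift i0 i) * (d i0 * z i0).
have [|e [De Ee [i ei]]] := IH z'.
  move=> i; exists 1; split=> //; first exact: subring_set1.
  have -> : 1 * z' i =
      c i0 * (d (lift i0 i) * z (lift i0 i) - c (lift i0 i) * m) +
      - c (lift i0 i) * (d i0 * z i0 - c i0 * m) by rewrite /z'; ring.
  apply: lin_spanD; apply: lin_spanM => //; exact: subring_setN.
have [e' [e'0 e'S]] := glue i0 (- \sum_i e i * c (lift i0 i) * d i0)
                               (fun i => e i * c i0 * d (lift i0 i)).
exists e'; split.
- move=> j; case: (unliftP i0 j) => [j'|] ->; rewrite ?e'0 ?e'S.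
    by apply: subring_setM => //; exact: subring_setM.
  apply: subring_setN; apply: subring_set_sum => j' _.
  by apply: subring_setM => //; exact: subring_setM.
- rewrite (bigD1_ord i0) //= e'0 mulNr mulr_suml -sumrN -big_split /=.
  move: Ee; congr E; apply: eq_bigr => j _; rewrite e'S /z'; ring.
- exists (lift i0 i); rewrite e'S; apply: notinE_mul => //.
    exact: subring_setM.
  exact: notinE_mul.
Qed.

Definition algebraic (x : R) : Prop := exists n (c : nat -> R),
  [/\ forall i, D (c i), ~ E (c n) & E (\sum_(i < n.+1) c i * x ^+ i)].

(** [M] consists of the monomials in [xs] with exponents below the degrees of the given
    relations. *)
Lemma algebraic_frac_span (xs : seq R) : (forall x, x \in xs -> algebraic x) ->
  exists M, frac_span M 1 /\
    forall x, x \in xs -> forall z, frac_span M z -> frac_span M (x * z).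
Proof.
elim: xs => [|x xs IH] alg.
  by exists [:: 1]; split=> //; apply: mem_frac_span; rewrite mem_head.
have [|M [M1 Mxs]] := IH; first by move=> y ys; apply: alg; rewrite inE ys orbT.
have [n [c [Dc Ec cE]]] := alg x (mem_head _ _).
pose M' := [seq x ^+ l * m | l <- iota 0 n, m <- M]; exists M'.
have sat := saturated_frac_span M'; have [NE ND NM Nd] := sat.
have lt_n l z : (l < n)%N -> frac_span M z -> frac_span M' (x ^+ l * z).
  move=> ln; apply: (frac_span_min (saturated_preim _ sat)) => m mM /=.
  by apply: mem_frac_span; apply/allpairsP; exists (l, m); rewrite mem_iota.
(* At [l = n] the relation expresses [c n * x ^+ n] by lower powers, and saturation removes
   [c n]. *)
have le_n l z : (l <= n)%N -> frac_span M z -> frac_span M' (x ^+ l * z).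
  rewrite leq_eqVlt => /orP[/eqP->|]; last exact: lt_n.
  move=> Mz; apply: (Nd (c n)) => //.
  have -> : c n * (x ^+ n * z) = z * (\sum_(i < n.+1) c i * x ^+ i)
      + \sum_(i < n) (- c i) * (x ^+ i * z).
    rewrite big_ord_recr /= mulrDr addrAC mulr_sumr -big_split /= big1 ?add0r.
      ring.
    by move=> i _; ring.
  apply: (ND); first by apply: NE; exact: idealMl.
  elim/big_ind: _ => [|u v|i _]; [by apply: NE; exact: ideal0|exact: ND|].
  by apply: NM; [exact: subring_setN|exact: lt_n].
split; first by rewrite -[1]mulr1 -(expr0 x); exact: le_n.
move=> y; rewrite inE => /orP[/eqP->|ys];
  apply: (frac_span_min (saturated_preim _ sat)) => m /allpairsP[[l m'] /=];
  rewrite mem_iota /= add0n => -[ln mM ->].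
  by rewrite mulrA -exprS; apply: le_n => //; exact: mem_frac_span.
by rewrite mulrCA; apply: lt_n => //; apply: Mxs => //; exact: mem_frac_span.
Qed.

(** Multiplication by [f] preserves a finite-dimensional span that contains 1, so the powers of [f]
    are dependent; [d] is the lowest coefficient outside [E], and [m] its index. *)
Lemma algebraic_comb (s : seq (R * R)) :
  (forall x, x \in s -> algebraic x.1 /\ D x.2) ->
  let f := \sum_(x <- s) x.1 * x.2 in
  exists m d g, [/\ D d, ~ E d & E (f ^+ m * (d - f * g))].
Proof.
move=> hs f; have [|M [M1 Mxs]] := @algebraic_frac_span [seq x.1 | x <- s].
  by move=> _ /mapP[x xs ->]; have [] := hs x xs.
have [NE ND NM Nd] := saturated_frac_span M.
have Mf z : frac_span M z -> frac_span M (f * z).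
  move=> Mz; rewrite mulr_suml big_seq.
  elim/big_ind: _ => [|u v|x xs]; [by apply: NE; exact: ideal0|exact: ND|].
  rewrite -mulrA; apply: Mxs; first by apply/mapP; exists x.
  by apply: NM => //; have [] := hs x xs.
have Mfj j : frac_span M (f ^+ j).
  by elim: j => [|j IH]; rewrite ?expr0 // exprS; exact: Mf.
have [e [De Ee eE]] := @frac_span_dep M (fun j => f ^+ j) (fun j => Mfj j).
(* Coefficients in [E] are removed from the bottom; each removal moves one factor [f] from the sum
   into [f ^+ m]. *)
suff h N m (e' : 'I_N -> R) : (forall i, D (e' i)) ->
    E (f ^+ m * \sum_i e' i * f ^+ i) -> (exists i, ~ E (e' i)) ->
    exists m d g, [/\ D d, ~ E d & E (f ^+ m * (d - f * g))].
  by apply: (h _ 0%N e) => //; rewrite expr0 mul1r.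
elim: N m e' => [|N IH] m e' De'; first by move=> _ [[]].
rewrite big_ord_recl expr0 mulr1.
have -> : \sum_(i < N) e' (lift ord0 i) * f ^+ lift ord0 i =
          f * \sum_(i < N) e' (lift ord0 i) * f ^+ i.
  by rewrite mulr_sumr; apply: eq_bigr => i _; rewrite exprS; ring.
have [e0|e0] := pselect (E (e' ord0)); last first.
  move=> h _; exists m, (e' ord0), (- \sum_(i < N) e' (lift ord0 i) * f ^+ i).
  by rewrite mulrN opprK.
rewrite mulrDr => h [j ej]; apply: (IH m.+1 (fun i => e' (lift ord0 i))) => //.
  rewrite exprSr -mulrA; apply: idealDl h => //; exact: idealMl.
by case: (unliftP ord0 j) => [i|] ji; rewrite ji in ej => //; exists i.
Qed.

End AlgebraicElements.

(** * Sums of extended primes have no embedded components *)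

Section PrimeSums.
Variables (k : fieldType) (A B R : comAlgType k).
Variables (iA : {lrmorphism A -> R}) (iB : {lrmorphism B -> R}).
Hypothesis hR : is_tensor_product iA iB.
Variables (p : prime_idealr A) (q : prime_idealr B).

Local Notation K := (ext_add iA iB).
Local Notation E := (K [set` p] [set` q]).

Let ip : ideal [set` p] := idealr_ideal p.
Let iq : ideal [set` q] := idealr_ideal q.
Let iE : ideal E := ext_add_ideal iA iB [set` p] [set` q].

Lemma prime_sumP z : E z <-> forall g, contraction iA iB [set` q] g -> g z \in
  p.
Proof. exact: ext_addP. Qed.

Lemma prime_sum_inA a : E (iA a) -> a \in p.
Proof.
have [|g gq g1] := contraction_ex hR (ideal_subspace iq) (b := 1).
  by rewrite /= idealr1.
move=> /prime_sumP /(_ _ gq); rewrite -[iA a]mulr1 (contractionM gq).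
by rewrite -(rmorph1 iB) g1 mulr1.
Qed.

Lemma prime_sum_inB b : E (iB b) -> b \in q.
Proof.
move=> Eb; apply: contraT => /negP qb.
have [g gq g1] := contraction_ex hR (ideal_subspace iq) qb.
by move/prime_sumP: Eb => /(_ _ gq); rewrite g1 idealr1.
Qed.

Lemma prime_sum1 : ~ E 1.
Proof. by rewrite -(rmorph1 iA) => /prime_sum_inA; rewrite idealr1. Qed.

Definition subalgebra (C : set A) : Prop :=
  [/\ forall c : k, C c%:A, forall u v, C u -> C v -> C (u - v)
    & forall u v, C u -> C v -> C (u * v)].

(** The image of [C (x) B] in [R]. *)
Definition base_ext (C : set A) : set R :=
  [set z | exists2 s : seq (A * B), (forall x, x \in s -> C x.1) &
           z = \sum_(x <- s) iA x.1 * iB x.2].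

Definition domain_ext (C : set A) : Prop :=
  forall u v, base_ext C u -> base_ext C v -> E (u * v) -> E u \/ E v.

Definition algebraicA (C : set A) (x : A) : Prop :=
  exists n (c : nat -> A), [/\ forall i, C (c i), c n \notin p &
    \sum_(i < n.+1) c i * x ^+ i \in p].

Lemma subalgebra_subring C : subalgebra C -> subring_set C.
Proof. by move=> [C1 CB CM]; split=> //; rewrite -(scale1r 1). Qed.

Section Subalgebra.
Variable C : set A.
Hypothesis sC : subalgebra C.
Let rC : subring_set C := subalgebra_subring sC.

Lemma base_extD u v : base_ext C u -> base_ext C v -> base_ext C (u + v).
Proof.
move=> [s sS ->] [t tS ->]; exists (s ++ t); last by rewrite big_cat.
by move=> x; rewrite mem_cat => /orP[/sS|/tS].
Qed.

Lemma base_ext_prod a b : C a -> base_ext C (iA a * iB b).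
Proof.
move=> Ca; exists [:: (a, b)]; last by rewrite big_seq1.
by move=> x; rewrite inE => /eqP->.
Qed.

Lemma base_ext_subring : subring_set (base_ext C).
Proof.
split.
- by rewrite -[1]mulr1 -{1}(rmorph1 iA) -(rmorph1 iB); apply: base_ext_prod;
  case: rC.
- move=> u _ hu [t tS ->]; apply: base_extD => //.
  exists [seq (- x.1, x.2) | x <- t].
    by move=> _ /mapP[x xt ->]; apply: (subring_setN rC); exact: tS.
  by rewrite big_map -sumrN; apply: eq_bigr => x _; rewrite rmorphN mulNr.
- move=> _ _ [s sS ->] [t tS ->].
  exists [seq (x.1 * y.1, x.2 * y.2) | x <- s, y <- t].
    move=> _ /allpairsP[[x y] [/= xs yt ->]].
    by apply: (subring_setM rC); [exact: sS|exact: tS].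
  rewrite big_allpairs_dep mulr_suml; apply: eq_bigr => x _.
  by rewrite mulr_sumr; apply: eq_bigr => y _ /=; rewrite !rmorphM; ring.
Qed.

Lemma base_ext_inA a : C a -> base_ext C (iA a).
Proof.
by move=> Ca; rewrite -[iA a]mulr1 -(rmorph1 iB); exact: base_ext_prod.
Qed.

Lemma base_ext_inB b : base_ext C (iB b).
Proof.
rewrite -[iB b]mul1r -(rmorph1 iA); apply: base_ext_prod;
  exact: subring_set1 rC.
Qed.

Lemma base_ext_contraction W g u :
  contraction iA iB W g -> base_ext C u -> C (g u).
Proof.
move=> gW [s sC' ->]; rewrite (contraction_sum gW) big_seq.
apply: (subring_set_sum rC) => x xs; rewrite (contractionM gW).
apply: (subring_setM rC); first exact: sC'.
by have [c ->] := contraction_in gW x.2; case: sC.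
Qed.

(** In a shortest representation of a counterexample the [A]-components are independent over [C]
    modulo [p], so the contractions of its product with [d] put every [d * w i] in [E]; then [dom]
    puts every [w i] there. *)
Lemma base_ext_regular d z : domain_ext C -> base_ext C d -> ~ E d ->
  E (d * z) -> E z.
Proof.
move=> dom Dd Ed Edz; apply: contrapT => Ez.
have sD := base_ext_subring.
have [s zE] := tensor_span hR z.
have [||||||n [a [w [_ Dw [Edw nEw] indep]]]] :=
  @independent_repr k A R iA C [set` p]
    [set` p] [set: A] (base_ext C) [set z | E (d * z) /\ ~ E z] (size s)
    (fun i => (nth (0, 0) s i).1) (fun i => iB (nth (0, 0) s i).2).
- move=> c c' u v Cc Cc' Du Dv.
  by apply: (subring_setB sD); apply: (subring_setM sD) => //;
    exact: base_ext_inA.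
- move=> y a r [Edy Ey] pa.
  have Ear : E (iA a * r) by apply: idealMr => //; exact: ext_addl.
  split; first by rewrite mulrBr; apply: idealB => //; exact: idealMl.
  by move=> h; apply: Ey; rewrite -(subrK (iA a * r) y); exact: idealD.
- move=> c y _ /negP cp [Edy Ey]; split; first by rewrite mulrCA;
  exact: idealMl.
  by move=> /(ext_add_regular hR iq cp).
- by [].
- by move=> i; exact: base_ext_inB.
- by move: Edz Ez; rewrite zE (big_nth (0, 0)) big_mkord.
apply: nEw; apply: ideal_sum => // i _; apply: idealMl => //.
have : E (d * w i).
  apply/prime_sumP => g gq; apply: (indep (fun i => g (d * w i))).
    move=> j; apply: base_ext_contraction gq _; exact: (subring_setM sD).
  move/prime_sumP: Edw => /(_ _ gq); rewrite /= mulr_sumr (contraction_sum gq).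
  congr (is_true (_ \in p)); apply: eq_bigr => j _.
  by rewrite mulrCA (contractionM gq) mulrC.
by move=> /dom[].
Qed.

Variable x : A.

Definition adjoin : set A :=
  [set a | exists2 P : {poly A}, (forall i, C P`_i) & a = P.[x]].

Lemma adjoin_sub : C `<=` adjoin.
Proof.
move=> c Cc; exists c%:P; last by rewrite hornerC.
by move=> i; rewrite coefC; case: ifP => // _; exact: subring_set0 rC.
Qed.

Lemma mem_adjoin : adjoin x.
Proof.
exists 'X; last by rewrite hornerX.
move=> i; rewrite coefX; case: eqP => _;
  [exact: subring_set1 rC|exact: subring_set0 rC].
Qed.

Lemma adjoin_subalgebra : subalgebra adjoin.
Proof.
split=> [c|_ _ [P CP ->] [Q CQ ->]|_ _ [P CP ->] [Q CQ ->]].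
- by apply: adjoin_sub; case: sC.
- exists (P - Q); last by rewrite hornerD hornerN.
  by move=> i; rewrite coefB; apply: (subring_setB rC).
- exists (P * Q); last by rewrite hornerM.
  by move=> i; rewrite coefM; apply: (subring_set_sum rC) => j _;
    apply: (subring_setM rC).
Qed.

Lemma base_ext_adjoin u : base_ext adjoin u ->
  exists2 U : {poly R}, (forall i, base_ext C U`_i) & u = U.[iA x].
Proof.
have sD := base_ext_subring.
move=> [s sS ->]; elim: s sS => [|[a b] s IH] sS.
  by exists 0; rewrite ?big_nil ?horner0 // => i; rewrite coef0;
    exact: subring_set0.
rewrite big_cons; have [|U DU ->] := IH; first by move=> y ys; apply: sS;
  rewrite inE ys orbT.
have [/= P CP ->] := sS _ (mem_head _ _).
exists (map_poly iA P * (iB b)%:P + U).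
  move=> i; rewrite coefD coefMC coef_map; apply: base_extD => //.
  exact: base_ext_prod.
by rewrite hornerD hornerM hornerC horner_map.
Qed.

(** Dropping leading terms with coefficient in [E] makes the degree meaningful modulo [E]. *)
Lemma poly_trim (U : {poly R}) : (forall i, base_ext C U`_i) -> ~ E U.[iA x] ->
  exists2 V : {poly R}, (forall i, base_ext C V`_i) &
    E (U.[iA x] - V.[iA x]) /\ ~ E (lead_coef V).
Proof.
have sD := base_ext_subring.
have [m] := ubnP (size U); elim: m U => // m IH U sU DU EU.
have [El|El] := pselect (E (lead_coef U)); last first.
  by exists U; rewrite ?subrr //; split=> //; exact: ideal0.
have U0 : (0 < size U)%N.
  by rewrite lt0n size_poly_eq0; apply/eqP => U0; apply: EU;
    rewrite U0 horner0; exact: ideal0.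
pose U' := \poly_(i < (size U).-1) U`_i.
have UE : U.[iA x] - U'.[iA x] = lead_coef U * iA x ^+ (size U).-1.
  rewrite horner_coef horner_poly /lead_coef.
  by case: (size U) U0 => // l _; rewrite big_ord_recr /= addrAC subrr add0r.
have EUU' : E (U.[iA x] - U'.[iA x]) by rewrite UE; exact: idealMr.
have [|i||V DV [EV lV]] := IH U'.
- by apply: leq_ltn_trans (size_poly _ _) _; rewrite prednK.
- by rewrite coef_poly; case: ifP => // _; exact: subring_set0.
- by move=> EU'; apply: EU; rewrite -(subrK U'.[iA x] U.[_]); exact: idealD.
exists V => //; split=> //.
by rewrite -(subrKA U'.[iA x]); exact: idealD.
Qed.

Hypothesis trx : ~ algebraicA C x.

Lemma transcendental_coef n (c : nat -> A) : (forall i, C (c i)) ->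
  \sum_(i < n) c i * x ^+ i \in p -> forall i, (i < n)%N -> c i \in p.
Proof.
move=> Cc; elim: n => // n IH h.
have cn : c n \in p by apply: contrapT => /negP cn; apply: trx; exists n, c.
move=> i; rewrite ltnS leq_eqVlt => /orP[/eqP->//|]; apply: IH.
have := h; rewrite big_ord_recr /= addrC; apply: (idealDl ip).
exact: (idealMr _ ip).
Qed.

(** A contraction turns a relation over [C (x) B] into one over [C], whose coefficients lie in [p]
    by transcendence. *)
Lemma transcendental_base_ext (W : {poly R}) : (forall i, base_ext C W`_i) ->
  E W.[iA x] -> forall i, E W`_i.
Proof.
move=> DW EW i; have [iW|Wi] := ltnP i (size W); last first.
  by rewrite nth_default //; exact: ideal0.
apply/prime_sumP => g gq.
apply: (@transcendental_coef (size W) (fun i => g W`_i)) => //.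
  by move=> j; exact: base_ext_contraction gq _.
move/prime_sumP: EW => /(_ _ gq); rewrite horner_coef (contraction_sum gq).
congr (is_true (_ \in p)); apply: eq_bigr => j _.
by rewrite mulrC -rmorphXn (contractionM gq) mulrC.
Qed.

(** As for polynomials over a domain: the product of the trimmed leading coefficients would lie in
    [E]. *)
Lemma domain_ext_adjoin : domain_ext C -> domain_ext adjoin.
Proof.
have sD := base_ext_subring.
move=> dom _ _ /base_ext_adjoin[U DU ->] /base_ext_adjoin[V DV ->] EUV.
apply: contrapT => /not_orP[/(poly_trim DU)[U' DU' [EU lU]] /(poly_trim DV)[V'
  DV' [EV lV]]].
have : E (U' * V').[iA x].
  rewrite hornerM.
  have -> : U'.[iA x] * V'.[iA x] = U.[iA x] * V.[iA x]
      - ((U.[iA x] - U'.[iA x]) * V.[iA x] + U'.[iA x] * (V.[iA x] - V'.[iA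
        x])) by ring.
  apply: idealB => //; apply: idealD => //; [exact: idealMr|exact: idealMl].
move=> /transcendental_base_ext h.
have [|//|//] := dom (lead_coef U') (lead_coef V') (DU' _) (DV' _).
rewrite mul_lead_coef; apply: h => i; rewrite coefM.
by apply: (subring_set_sum sD) => j _; exact: (subring_setM sD).
Qed.

End Subalgebra.

(** Here [C (x) B] is the image of [B], on which [E] induces the prime [q]. *)
Lemma domain_ext_scalars : domain_ext [set a | exists c : k, a = c%:A].
Proof.
have inB u : base_ext [set a | exists c : k, a = c%:A] u -> exists b, u = iB b.
  move=> [s sS ->]; elim: s sS => [|[a b] s IH] sS.
    by exists 0; rewrite big_nil rmorph0.
  rewrite big_cons; have [|b' ->] := IH; first by move=> y ys; apply: sS;
    rewrite inE ys orbT.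
  have [/= c ->] := sS _ (mem_head _ _).
  exists (c *: b + b'); rewrite /= linearP linearZ rmorph1.
  by rewrite -scalerAl mul1r.
move=> _ _ /inB[b ->] /inB[b' ->]; rewrite -rmorphM => /prime_sum_inB.
by rewrite prime_idealrM => /orP[] h; [left|right]; exact: ext_addr.
Qed.

(** An element is adjoined to [C] only if it is transcendental over what has been built so far,
    which keeps [domain_ext]. *)
Lemma algebraic_over_domain (xs : seq A) : exists C : set A,
  [/\ subalgebra C, domain_ext C & forall x, x \in xs -> algebraicA C x].
Proof.
elim: xs => [|x xs [C [sC dC aC]]].
  exists [set a | exists c : k, a = c%:A]; split=> //;
    last exact: domain_ext_scalars.
  split=> [c|_ _ [c ->] [d ->]|_ _ [c ->] [d ->]]; first by exists c.
    by exists (c - d); rewrite scalerBl.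
  by exists (c * d); rewrite -scalerAl mul1r scalerA.
have [xa|xt] := pselect (algebraicA C x).
  by exists C; split=> // y; rewrite inE => /orP[/eqP->|/aC].
have sC' := adjoin_subalgebra sC x.
exists (adjoin C x); split=> //; first exact: domain_ext_adjoin.
move=> y; rewrite inE => /orP[/eqP->|/aC[n [c [Cc cn ca]]]]; last first.
  by exists n, c; split=> // i; exact: adjoin_sub.
(* The polynomial [X - x] shows that [x] is algebraic over [C[x]]. *)
exists 1%N, (fun i => if i is 0 then - x else 1); split.
- have rC' := subalgebra_subring sC'.
  case=> [|_]; last exact: subring_set1 rC'.
  apply: (subring_setN rC'); exact: mem_adjoin.
- by rewrite idealr1.
- by rewrite !big_ord_recl big_ord0 /= expr0 mulr1 mul1r addr0 expr1 addNr
  rpred0.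
Qed.

Lemma prime_sum_pi_regular f : exists m d g,
  (forall z, E (d * z) -> E z) /\ E (f ^+ m * (d - f * g)).
Proof.
have [s ->] := tensor_span hR f.
have [C [sC dC aC]] := algebraic_over_domain [seq x.1 | x <- s].
have sD := base_ext_subring sC.
have [|m [d [g [Dd Ed h]]]] :=
  @algebraic_comb R (base_ext C) E sD iE prime_sum1 dC
    [seq (iA x.1, iB x.2) | x <- s].
  move=> _ /mapP[x xs ->]; split; last exact: base_ext_inB.
  have [|n [c [Cc cn ca]]] := aC x.1; first by apply/mapP; exists x.
  exists n, (fun i => iA (c i)); split=> [i||].
  - exact: base_ext_inA.
  - by move=> /prime_sum_inA; rewrite (negbTE cn).
  - have : E (iA (\sum_(i < n.+1) c i * x.1 ^+ i)) by exact: ext_addl.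
    by congr E; rewrite rmorph_sum; apply: eq_bigr => i _;
      rewrite rmorphM rmorphXn.
exists m, d, g; split=> [z|]; last by rewrite big_map in h.
exact: (base_ext_regular sC dC Dd Ed).
Qed.

(** An element of [L + E] regular modulo [E] suffices. Without one, some prime [P] over [L + E] has
    no regular elements; [prime_sum_pi_regular] makes it minimal over [E], so it cannot contain
    [L]. *)
Lemma prime_sum_unmixed (L : set R) w : noetherian R -> ideal L ->
  (forall P, minimal_prime E P -> exists2 l, L l & l \notin P) ->
  (forall l, L l -> E (l * w)) -> E w.
Proof.
move=> noeth iL LP Lw.
suff [d [[l Ll [e Ee <-]] dreg]] :
    exists d, ideal_add L E d /\ forall z, E (d * z) -> E z.
  by apply: dreg; rewrite mulrDl; apply: idealD => //;
    [exact: Lw|exact: idealMr].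
apply: contrapT => no.
have iLE := ideal_add_ideal iL iE.
have [||x LEx xreg|P [LEP Preg]] := @prime_avoiding R (ideal_add L E)
    [set d | forall z, E (d * z) -> E z] noeth iLE.
- by move=> z; rewrite mul1r.
- by move=> a b ha hb z; rewrite -mulrA => /ha/hb.
- by apply: no; exists x.
have [l Ll /negP[]] : exists2 l, L l & l \notin P; last first.
  by apply: LEP; exact: ideal_addl.
apply: LP; split=> [x Ex|P' EP' P'P]; first by apply: LEP; exact: ideal_addr.
(* An [f] in [P] but not in [P'] puts [d - f * g] in [P'], and hence the regular element [d] in
   [P]. *)
apply/seteqP; split=> // f /= fP; apply: contraT => fP'.
have [m [d [g [dreg]]]] := prime_sum_pi_regular f.
move=> /EP' /=; rewrite prime_idealrM => /orP[|dP'].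
  elim: m => [|m IH]; first by rewrite expr0 idealr1.
  by rewrite exprS prime_idealrM (negbTE fP') => /IH.
have dP : d \in P.
  by rewrite -(subrK (f * g) d) rpredD //;
    [exact: P'P|rewrite prime_idealrM fP].
by case: (Preg d dP).
Qed.

End PrimeSums.

(** * Symbolic powers of a sum *)

(** As [x] is not in the symbolic power, some minimal prime [P] of [I] contains every [s] with
    [s * x] in [I^t]; thus [p] lies in [P], and minimality of [P] makes them equal. *)
Lemma associated_prime_minimal (S : comNzRingType) (I : set S) t x
    (p : prime_idealr S) : symbolic_power I t = ideal_exp I t ->
  ideal_exp I t `<=` [set` p] -> ~ ideal_exp I t x ->
  (forall s, s \in p -> ideal_exp I t (s * x)) -> minimal_prime I p.
Proof.
move=> It tp; rewrite -{1}It => /symbolic_powerP nx px.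
have [P [Pmin PP]] : exists P : prime_idealr S, minimal_prime I P /\
    forall s, ideal_exp I t (s * x) -> s \in P.
  apply: contrapT => no; apply: nx => P Pmin; apply: contrapT => nP.
  apply: no; exists P; split=> // s sx; apply: contraT => sP.
  by case: nP; exists s.
have Ip := mem_prime_exp tp.
have pP : [set` p] = [set` P] by apply: Pmin.2 => // s /px/PP.
by split=> //; rewrite pP; exact: Pmin.2.
Qed.

Section SymbolicPowersOfSums.
Variables (k : fieldType) (A B R : comAlgType k).
Variables (iA : {lrmorphism A -> R}) (iB : {lrmorphism B -> R}).
Hypothesis hR : is_tensor_product iA iB.
Hypothesis noethR : noetherian R.

(** A prime [P'] over [K(I, J)] inside [P] contracts into [p] and [q], hence to [p] and [q] by their
    minimality, and so contains [K(p, q)]. *)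
Lemma minimal_prime_sum (I : set A) (J : set B) (p : prime_idealr A)
    (q : prime_idealr B) (P : prime_idealr R) :
  minimal_prime I p -> minimal_prime J q ->
  minimal_prime (ext_add iA iB [set` p] [set` q]) P ->
  minimal_prime (ext_add iA iB I J) P.
Proof.
move=> [Ip pmin] [Jq qmin] Pmin; split.
  apply: subset_trans Pmin.1; apply: ext_add_sub; first exact: ext_add_ideal.
    by move=> x /Ip; exact: ext_addl.
  by move=> x /Jq; exact: ext_addr.
move=> P' IJP' P'P; apply: Pmin.2 => //.
apply: ext_add_sub => [|x px|x qx]; first exact: idealr_ideal.
  have [p' p'E] := prime_preim_ex iA P'.
  suff e : [set` p'] = [set` p] by move: px; rewrite -e p'E.
  apply: pmin; rewrite p'E => s /= hs; first by apply: IJP'; exact: ext_addl.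
  by apply: (minimal_prime_preim hR noethR (idealr_ideal q) Pmin); exact: P'P.
have [q' q'E] := prime_preim_ex iB P'.
suff e : [set` q'] = [set` q] by move: qx; rewrite -e q'E.
apply: qmin; rewrite q'E => s /= hs; first by apply: IJP'; exact: ext_addr.
rewrite /ext_add ideal_addC in Pmin.
apply: (minimal_prime_preim (is_tensor_product_sym hR) noethR (idealr_ideal p)
  Pmin).
exact: P'P.
Qed.

(** [colon_ext_add] is applied on each side in turn, replacing [I^i] by [p] and [J^j] by [q];
    [prime_sum_unmixed] settles what remains. *)
Lemma symbolic_power_sum_sub (I : set A) (J : set B) n : noetherian A ->
  noetherian B -> ideal I -> ideal J ->
  (forall t, (1 <= t <= n)%N -> symbolic_power I t = ideal_exp I t /\
                                symbolic_power J t = ideal_exp J t) ->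
  symbolic_power (ext_add iA iB I J) n `<=` ideal_exp (ext_add iA iB I J) n.
Proof.
move=> noethA noethB iI iJ symb z /symbolic_powerP zP.
have hS := is_tensor_product_sym hR.
pose L := [set l | forall y, y = z -> ideal_exp (ext_add iA iB I J) n (l * y)].
have iL : ideal L by apply: (ideal_colon [set y | y = z]);
  exact: ideal_exp_ideal.
apply: inter_ext_add => // i /andP[i0 ni].
have [It _] : symbolic_power I i = ideal_exp I i /\ symbolic_power J i =
  ideal_exp J i.
  by apply: symb; rewrite i0.
set j := (n.+1 - i)%N.
have [_ Jt] : symbolic_power I j = ideal_exp I j /\ symbolic_power J j =
  ideal_exp J j.
  apply: symb; rewrite /j subn_gt0 ltnS ni /=; lia.
(* Elements of [L] multiply [z] into [K(I^i, J^j)] because [i + j = n + 1]. *)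
apply: (colon_ext_add hR (L := L)) => //; try exact: ideal_exp_ideal;
  last first.
  move=> l /(_ _ erefl); apply: exp_ext_add_sub; rewrite /j; lia.
move=> p Ip [x Ix px] w Lw.
have pmin := associated_prime_minimal It Ip Ix px.
rewrite /ext_add ideal_addC.
apply: (colon_ext_add hS (L := L)) => //.
- exact: ideal_exp_ideal.
- exact: idealr_ideal.
- move=> q Jq [y Jy qy] v; rewrite /ext_add ideal_addC => Lv.
  have qmin := associated_prime_minimal Jt Jq Jy qy.
  apply: (prime_sum_unmixed hR noethR iL) => // P Pmin.
  have [s sP sz] := zP P (minimal_prime_sum pmin qmin Pmin).
  by exists s => // _ ->.
- by move=> l /Lw; rewrite /ext_add ideal_addC.
Qed.

Lemma symbolic_power_summand (I : set A) (J : set B) n t : ideal I -> ideal J ->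
  (t <= n)%N -> ideal_exp J (n - t) <> ideal_exp J (n - t).+1 ->
  symbolic_power (ext_add iA iB I J) n = ideal_exp (ext_add iA iB I J) n ->
  symbolic_power I t = ideal_exp I t.
Proof.
move=> iI iJ tn Jnt symb.
apply/seteqP; split=> [x|]; last exact: sub_symbolic_power.
move=> /symbolic_powerP xP.
have [y Jy nJy] : exists2 y, ideal_exp J (n - t) y & ~ ideal_exp J (n - t).+1 y.
  apply: contrapT => no; apply: Jnt; apply/seteqP; split=> [y Jy|].
    by apply: contrapT => nJy; apply: no; exists y.
  exact: ideal_exp_subl.
have iK := ext_add_ideal iA iB I J.
have : ideal_exp (ext_add iA iB I J) n (iA x * iB y).
  (* The multiplier for [x] at the minimal prime [p] of [I] below [P] also serves for the product at
     [P]. *)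
  rewrite -symb; apply/symbolic_powerP => P Pmin.
  have [p pmin pP] := minimal_prime_contract hR noethR iJ Pmin.
  have [s sp sx] := xP p pmin; exists (iA s).
    by apply: contra sp; exact: pP.
  rewrite mulrA -rmorphM -(subnKC tn); apply: ideal_expM; apply: exp_ext.
  - by [].
  - by move=> u; exact: ext_addl.
  - exact: sx.
  - by [].
  - by move=> u; exact: ext_addr.
  - exact: Jy.
have iJE := @ideal_exp_ideal _ J (n - t).+1.
have iIE := @ideal_exp_ideal _ I t.
move=> /(@exp_ext_add_sub _ _ _ _ iA iB I J t (n - t).+1 n) h.
have /h/(ext_addP hR iJE _ iIE) H : (t + (n - t).+1 <= n.+1)%N by rewrite addnS
  subnKC.
have [g gJ gy] := contraction_ex hR (ideal_subspace iJE) nJy.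
by have := H g gJ; rewrite (contractionM gJ) gy mulr1.
Qed.

End SymbolicPowersOfSums.

Theorem corollary3p5 (k : fieldType) (A B R : comAlgType k)
    (iA : {lrmorphism A -> R}) (iB : {lrmorphism B -> R})
    (hR : is_tensor_product iA iB)
    (noethA : noetherian A) (noethB : noetherian B) (noethR : noetherian R)
    (I : set A) (J : set B) (hI : ideal I) (hJ : ideal J)
    (hI0 : I <> [set 0]%classic) (hI1 : I <> setT)
    (hJ0 : J <> [set 0]%classic) (hJ1 : J <> setT)
    (n : nat) (hn : (1 <= n)%N)
    (hIt : forall t : nat, (t <= n.-1)%N -> ideal_exp I t <> ideal_exp I t.+1)
    (hJt : forall t : nat, (t <= n.-1)%N -> ideal_exp J t <> ideal_exp J t.+1) :
  let IJ : set R := ideal_add (extension iA I) (extension iB J) in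
  symbolic_power IJ n = ideal_exp IJ n <->
  (forall t : nat, (1 <= t <= n)%N ->
     symbolic_power I t = ideal_exp I t /\
     symbolic_power J t = ideal_exp J t).
Proof.
move=> IJ; have hS := is_tensor_product_sym hR.
split=> [symb t /andP[t0 tn]|symb].
  (* This uses [1 <= t]: the exponent [n - t] stays in the range where consecutive powers differ. *)
  have nt : (n - t <= n.-1)%N by lia.
  split; first exact: (symbolic_power_summand hR noethR hI hJ tn (hJt _ nt)
    symb).
  rewrite /IJ ideal_addC in symb.
  exact: (symbolic_power_summand hS noethR hJ hI tn (hIt _ nt) symb).
apply/seteqP; split; last exact: sub_symbolic_power.
exact: (symbolic_power_sum_sub hR noethR noethA noethB hI hJ symb).
Qed.
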